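(* Let $p\in\mathbb{C}\setminus\mathbb{Z}_{\leqslant 0}$, $m\in\mathbb{Z}_{\geqslant 0}$ and $n\in\mathbb{Z}_{\geqslant 0}$. Then \[ \sum_{k=1}^{\infty}\frac{(-1)^n}{k\,(p+n+k)^{m+1}\binom{n+k}{k}}=\sum_{k=0}^{n}\frac{(-1)^k}{(p+k)^{m+1}}\binom{n}{k}\big(H_n-H_{n-k}\big)-\frac{(-1)^m}{m!}\,\frac{\partial}{\partial x}\frac{\partial^m}{\partial s^m}\frac{\Gamma(x+1)\Gamma(s)}{\Gamma(x+s+1)}\bigg|_{x=n,\,s=p}. \]
   Context: $\Gamma$ is Euler's gamma function, $H_n=\sum_{j=1}^n 1/j$ the harmonic numbers with $H_0=0$, and $\binom{a}{b}$ the usual binomial coefficient. *)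

(* Defs.v *)
From HB Require Import structures.
From mathcomp Require Import all_boot all_order all_algebra.
From mathcomp Require Import complex.
From mathcomp Require Import all_classical all_reals all_analysis.

Set Implicit Arguments.
Unset Strict Implicit.
Unset Printing Implicit Defensive.

Import Order.TTheory GRing.Theory Num.Theory.
Import numFieldNormedType.Exports.

Local Open Scope ring_scope.
Local Open Scope classical_set_scope.

(* R[i] packed as a numClosedFieldType: the library equips every
   numClosedFieldType with the topology of its norm and a normed module
   structure over itself, but declares neither on the bare type R[i]. *)
Definition cplx (R : realType) : numClosedFieldType := (R[i])%C.

Definition cexp (R : realType) (z : cplx R) : cplx R :=
  (expR (complex.Re z) * cos (complex.Im z)
   +i* (expR (complex.Re z) * sin (complex.Im z)))%C.

(* N ^ z = exp (z ln N); only the values at N > 0 are meaningful, as ln 0 = 0 *)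
Definition natpowC (R : realType) (N : nat) (z : cplx R) : cplx R :=
  cexp (z * ((ln (N%:R : R))%:C)%C).

(* Euler's limit formula
     Gamma z = lim_(N -> oo) N! N^z / (z (z + 1) ... (z + N)),
   valid for every complex z that is not a nonpositive integer. *)
Definition Gamma (R : realType) (z : cplx R) : cplx R :=
  lim ((N`!%:R * natpowC N z / \prod_(j < N.+1) (z + j%:R)) @[N --> \oo]).

Definition harm (K : fieldType) (n : nat) : K := \sum_(1 <= j < n.+1) j%:R^-1.

(* Main.v *)
(* For x close to n the Beta quotient expands into partial fractions in s,

     Gamma(x+1) Gamma(s) / Gamma(x+s+1) = sum_k (-1)^k binom(x,k) / (s+k),

   so applying (-1)^m/m! d^m/ds^m at s = p replaces 1/(s+k) by
   1/(p+k)^(m+1).  Differentiating binom(x,k) at x = n gives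
   binom(n,k) (H_n - H_(n-k)) for k <= n, the finite sum, and
   (-1)^(j-1) / (j binom(n+j,j)) for k = n+j > n, the infinite one.

   Euler's limit formula makes the quotient the limit of
   N! prod_(j<=N) (x+s+1+j) / ((x+1+j)(s+j)); the partial fraction
   coefficients of this product in s are bounded by |binom(x,k)| and converge
   to (-1)^k binom(x,k).  The passage to the limit and both differentiations
   are instances of Tannery's theorem with a single telescoping majorant. *)
Require Import Defs.
From mathcomp Require Import all_boot all_order all_algebra.
From mathcomp Require Import complex.
From mathcomp Require Import all_classical all_reals all_analysis.
From mathcomp Require Import ring lra.
Set Implicit Arguments.
Unset Strict Implicit.
Unset Printing Implicit Defensive.
Import Order.TTheory GRing.Theory Num.Theory.
Import numFieldNormedType.Exports.
Local Open Scope ring_scope.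
Local Open Scope classical_set_scope.

(** * Real-valued norm and convergence in the complex numbers *)

Section complex_norm.
Variable R : realType.
Implicit Types (z w : cplx R) (k : nat).

(** The obstacle is uniformity. For [x] within [1/2] of [n] the factor [|i - x|] is at most
    [i + 1/2] once [i >= n], so the coefficients are of size [wallis k], about [k^(-1/2)], and the
    factor [1/(s + k)] supplies the missing power of [k]. Difference quotients are put into closed
    forms without division by [h] ([inv_quotient], [dsbin]), which admit bounds of the same type
    uniformly in small [h]. Since [Gamma] is a bare limit, its existence and its nonvanishing away
    from the poles must come first: consecutive terms of Euler's sequence have ratio [1 + O(1/N^2)],
    which the same majorant controls. At finite [N] the Beta product is a rational function of [s]
    that does not vanish at infinity; its constant part [beta_const] has to be shown to tend to
    0. *)

Definition cnorm z : R := complex.Re `|z|.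

(** The norm of [cplx R] has values in [cplx R] itself; [cnorm] is its real-valued copy, on which
    real order arguments work. *)
Lemma cnormE z : `|z| = (cnorm z)%:C%C :> cplx R.
Proof. by rewrite /cnorm RRe_real// normr_real. Qed.

Lemma cnorm_sqrt z :
  cnorm z = Num.sqrt (complex.Re z ^+ 2 + complex.Im z ^+ 2).
Proof. by rewrite /cnorm [`|z|]normc_def. Qed.

Lemma cnorm_ge0 z : 0 <= cnorm z.
Proof. by rewrite cnorm_sqrt sqrtr_ge0. Qed.

Lemma cnormM z w : cnorm (z * w) = cnorm z * cnorm w.
Proof. by apply: complexI; rewrite rmorphM/= -!cnormE normrM. Qed.

Lemma ler_cnormD z w : cnorm (z + w) <= cnorm z + cnorm w.
Proof. by rewrite -lecR rmorphD/= -!cnormE ler_normD. Qed.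

Lemma cnormN z : cnorm (- z) = cnorm z.
Proof. by rewrite /cnorm normrN. Qed.

Lemma cdistC z w : cnorm (z - w) = cnorm (w - z).
Proof. by rewrite -cnormN opprB. Qed.

Lemma cnorm0 : cnorm 0 = 0. Proof. by rewrite /cnorm normr0. Qed.

Lemma cnorm1 : cnorm 1 = 1. Proof. by rewrite /cnorm normr1. Qed.

Lemma cnorm_eq0 z : (cnorm z == 0) = (z == 0).
Proof. by rewrite -(inj_eq (@complexI R)) -cnormE normr_eq0. Qed.

Lemma cnorm_gt0 z : (0 < cnorm z) = (z != 0).
Proof. by rewrite lt_def cnorm_ge0 andbT cnorm_eq0. Qed.

Lemma cnormV z : cnorm z^-1 = (cnorm z)^-1.
Proof. by apply: complexI; rewrite fmorphV/= -!cnormE normfV. Qed.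

Lemma cnormX z k : cnorm (z ^+ k) = cnorm z ^+ k.
Proof. by elim: k => [|k IH]; rewrite ?expr0 ?cnorm1// !exprS cnormM IH. Qed.

Lemma cnorm_real (x : R) : cnorm (x%:C%C : cplx R) = `|x|.
Proof. by rewrite cnorm_sqrt /= expr0n addr0 sqrtr_sqr. Qed.

Lemma natrC k : (k%:R : cplx R) = (k%:R : R)%:C%C.
Proof. by rewrite rmorph_nat. Qed.

Lemma cnorm_nat k : cnorm k%:R = k%:R.
Proof. by rewrite natrC cnorm_real normr_nat. Qed.

Lemma ler_cnorm_sum (I : Type) (r : seq I) (P : pred I) (F : I -> cplx R) :
  cnorm (\sum_(i <- r | P i) F i) <= \sum_(i <- r | P i) cnorm (F i).
Proof.
elim/big_rec2 : _ => [|i y x _ IH]; first by rewrite cnorm0.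
by apply: le_trans (ler_cnormD _ _) _; rewrite lerD2l.
Qed.

Lemma cnorm_prod (I : Type) (r : seq I) (P : pred I) (F : I -> cplx R) :
  cnorm (\prod_(i <- r | P i) F i) = \prod_(i <- r | P i) cnorm (F i).
Proof. by apply: (big_morph cnorm cnormM cnorm1). Qed.

Lemma ler_Re_cnorm z : `|complex.Re z| <= cnorm z.
Proof. by rewrite -lecR -cnormE normc_ge_Re. Qed.

Lemma ler_Im_cnorm z : `|complex.Im z| <= cnorm z.
Proof.
by rewrite cnorm_sqrt -sqrtr_sqr ler_wsqrtr// lerDr sqr_ge0.
Qed.

Lemma ler_cnorm_ReIm z : cnorm z <= `|complex.Re z| + `|complex.Im z|.
Proof.
have -> (a b : R) : `|a| + `|b| = Num.sqrt ((`|a| + `|b|) ^+ 2).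
  by rewrite sqrtr_sqr [RHS]ger0_norm ?addr_ge0.
rewrite cnorm_sqrt ler_wsqrtr//.
by rewrite sqrrD !real_normK ?num_real// addrAC lerDl mulrn_wge0.
Qed.

Lemma ler_cnormB z w : cnorm z - cnorm w <= cnorm (z - w).
Proof. by rewrite lerBlDr -{1}(subrK w z) ler_cnormD. Qed.

Lemma ReD z w : complex.Re (z + w) = complex.Re z + complex.Re w.
Proof. by case: z w => [? ?] [? ?]. Qed.

Lemma ImD z w : complex.Im (z + w) = complex.Im z + complex.Im w.
Proof. by case: z w => [? ?] [? ?]. Qed.

Lemma ReB z w : complex.Re (z - w) = complex.Re z - complex.Re w.
Proof. by case: z w => [? ?] [? ?]. Qed.

Lemma ImB z w : complex.Im (z - w) = complex.Im z - complex.Im w.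
Proof. by case: z w => [? ?] [? ?]. Qed.

Lemma Re_nat k : complex.Re (k%:R : cplx R) = k%:R.
Proof. by rewrite natrC. Qed.

Lemma cplxP (z w : cplx R) :
  complex.Re z = complex.Re w -> complex.Im z = complex.Im w -> z = w.
Proof. by case: z w => [? ?] [? ?] /= -> ->. Qed.

(** A positive element of [cplx R] is real, so complex tolerances reduce to real ones. *)
Lemma cvgcP (T : Type) (F : set_system T) {FF : Filter F}
    (f : T -> cplx R) (l : cplx R) :
  (f x @[x --> F] --> l) <->
  (forall e : R, 0 < e -> \forall x \near F, cnorm (l - f x) < e).
Proof.
split=> [/cvgrPdist_lt fl e e0|fl].
  have := fl e%:C%C; rewrite ltcR => /(_ e0).
  by apply: filterS => x; rewrite cnormE ltcR.
apply/cvgrPdist_lt => eps eps0.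
have /RRe_real epsE : eps \is Num.real by exact: gtr0_real.
have := fl (complex.Re eps); rewrite -ltcR epsE => /(_ eps0).
by apply: filterS => x; rewrite -ltcR epsE cnormE.
Qed.

Lemma cvg_ReIm (T : Type) (F : set_system T) {FF : Filter F}
    (f : T -> cplx R) (l : cplx R) :
  (complex.Re (f x) @[x --> F] --> complex.Re l) ->
  (complex.Im (f x) @[x --> F] --> complex.Im l) ->
  (f x @[x --> F] --> l).
Proof.
move=> /cvgrPdist_lt fr /cvgrPdist_lt fi; apply/cvgcP => e e0.
have e20 : 0 < e / 2 by lra.
near=> x; apply: le_lt_trans (ler_cnorm_ReIm _) _; rewrite ReB ImB.
rewrite [e]splitr ltrD//; near: x; [exact: fr | exact: fi].
Unshelve. all: by end_near. Qed.

Lemma near_cnorm (z : cplx R) (e : R) : 0 < e ->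
  \forall h \near nbhs z, cnorm (h - z) < e.
Proof.
move=> e0; have : id x @[x --> z] --> z by exact: cvg_id.
by move/cvgcP => /(_ _ e0); apply: filterS => x; rewrite cdistC.
Qed.

Lemma near0_cnorm (e : R) : 0 < e ->
  \forall h \near (0 : cplx R)^', cnorm h < e.
Proof.
move=> e0; apply: (@cvg_within (cplx R)).
by near=> h; rewrite -[h]subr0; near: h; apply: near_cnorm.
Unshelve. all: by end_near. Qed.

End complex_norm.

(** * Dominated series and Tannery's theorem *)

Section dominated_series.
Variable R : realType.

(* The central binomial ratio 'C(2k, k) / 4^k; the decrements of this sequence
   are the majorants of all the series below. *)
Definition wallis (k : nat) : R := \prod_(i < k) ((i%:R + 2^-1) / i.+1%:R).

Definition majorant (k : nat) : R := wallis k / k.+1%:R.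

Lemma wallis0 : wallis 0 = 1.
Proof. by rewrite /wallis big_ord0. Qed.

Lemma wallisS k : wallis k.+1 = wallis k * ((k%:R + 2^-1) / k.+1%:R).
Proof. by rewrite /wallis big_ord_recr. Qed.

Lemma wallis_gt0 k : 0 < wallis k.
Proof.
by apply: prodr_gt0 => i _; rewrite divr_gt0// ltr_wpDl.
Qed.

Lemma majorant_gt0 k : 0 < majorant k.
Proof. by rewrite divr_gt0 ?wallis_gt0. Qed.

(** The ratio [wallis k.+1 / wallis k] is [1 - (1/2)/(k+1)]. Partial sums of the majorant then stay
    below 2 by positivity of [wallis] alone. *)
Lemma majorantE k : majorant k = 2 * (wallis k - wallis k.+1).
Proof.
rewrite /majorant wallisS -natr1; have : (0 : R) <= k%:R by [].
by move: (k%:R : R) => x x0; field; lra.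
Qed.

Lemma series_majorant N : series majorant N = 2 * (1 - wallis N).
Proof.
rewrite /series/= (eq_bigr (fun k => -2 * (wallis k.+1 - wallis k))); last first.
  by move=> k _; rewrite majorantE; ring.
by rewrite -mulr_sumr telescope_sumr// wallis0; ring.
Qed.

Lemma is_cvg_series_majorant : cvgn (series majorant).
Proof.
apply: nondecreasing_is_cvgn.
  by apply: nondecreasing_series => k _ _; exact/ltW/majorant_gt0.
exists 2 => _ [N _ <-]; rewrite series_majorant.
by have := wallis_gt0 N; lra.
Qed.

(** Brings errors of order [1/k^2], those of Euler's product, under the common majorant. It amounts
    to [wallis] decaying no faster than [1/(k+1)]. *)
Lemma inv_sqr_le_majorant k : k.+1%:R^-1 ^+ 2 <= 2 * majorant k.
Proof.
suff h : k.+1%:R^-1 <= 2 * wallis k.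
  by rewrite /majorant expr2 mulrA ler_wpM2r// invr_ge0.
elim: k => [|k IH]; first by rewrite wallis0 invr1; lra.
rewrite wallisS mulrA; apply: (@le_trans _ _ (k.+1%:R^-1 * ((k%:R + 2^-1) / k.+1%:R))).
  rewrite -[k.+2%:R]natr1 -[k.+1%:R]natr1; have : (0 : R) <= k%:R by [].
  move: (k%:R : R) => x x0.
  rewrite -subr_ge0.
  have -> : (x + 1)^-1 * ((x + 2^-1) / (x + 1)) - (x + 1 + 1)^-1 =
     (x / 2) / ((x + 1) ^+ 2 * (x + 1 + 1)) by field; lra.
  by rewrite divr_ge0 ?mulr_ge0 ?exprn_ge0//; lra.
by rewrite ler_wpM2r// divr_ge0// addr_ge0// invr_ge0.
Qed.

Definition dominated (C : R) (a : nat -> cplx R) :=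
  forall k, cnorm (a k) <= C * majorant k.

Definition csum (a : nat -> cplx R) : cplx R := limn (series a).

Lemma is_cvg_series_dominated_real C (b : nat -> R) :
  (forall k, `|b k| <= C * majorant k) -> cvgn (series b).
Proof.
move=> bC; apply: normed_cvg; rewrite /normed_series_of/=.
apply: (series_le_cvg (v_ := fun k => C * majorant k)) => //.
  by move=> k; apply: le_trans (bC k).
have -> : (fun k => C * majorant k) = C *: majorant by [].
exact/is_cvg_seriesZ/is_cvg_series_majorant.
Qed.

Lemma Re_series (a : nat -> cplx R) N :
  complex.Re (series a N) = series (fun k => complex.Re (a k)) N.
Proof.
by rewrite /series/=; apply: (big_morph (fun z : cplx R => complex.Re z) (@ReD R)).
Qed.

Lemma Im_series (a : nat -> cplx R) N :
  complex.Im (series a N) = series (fun k => complex.Im (a k)) N.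
Proof.
by rewrite /series/=; apply: (big_morph (fun z : cplx R => complex.Im z) (@ImD R)).
Qed.

Lemma cvg_csum C a : dominated C a -> series a x @[x --> \oo] --> csum a.
Proof.
move=> aC.
pose l : cplx R := (limn (series (fun k => complex.Re (a k))) +i*
                    limn (series (fun k => complex.Im (a k))))%C.
suff al : series a x @[x --> \oo] --> l by rewrite /csum (cvg_lim _ al).
apply: cvg_ReIm => /=.
- under eq_fun do rewrite Re_series.
  apply: is_cvg_series_dominated_real => k.
  exact: le_trans (ler_Re_cnorm _) (aC k).
- under eq_fun do rewrite Im_series.
  apply: is_cvg_series_dominated_real => k.
  exact: le_trans (ler_Im_cnorm _) (aC k).
Qed.

Lemma csum_unique (a : nat -> cplx R) l :
  series a x @[x --> \oo] --> l -> csum a = l.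
Proof. exact: cvg_lim. Qed.

Lemma csum_finite (a : nat -> cplx R) N :
  (forall k, (N <= k)%N -> a k = 0) -> csum a = \sum_(0 <= k < N) a k.
Proof.
move=> a0; apply: csum_unique.
apply: cvg_near_cst; near=> M.
have NM : (N <= M)%N by near: M; exact: nbhs_infty_ge.
rewrite /series/= (big_cat_nat _ NM)//= [X in _ + X]big_nat_cond.
rewrite [X in _ + X]big1 ?addr0//.
by move=> i; rewrite andbT => /andP[/a0].
Unshelve. all: by end_near. Qed.

Lemma csum_diff C c a b : dominated C a -> dominated C b ->
  c * (csum a - csum b) = csum (fun k => c * (a k - b k)).
Proof.
move=> aC bC; apply/esym/csum_unique.
have -> : series (fun k => c * (a k - b k)) =
    fun N => c * (series a N - series b N).
  by apply/funext => N; rewrite /series/= -mulr_sumr sumrB.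
exact: cvgM (cvg_cst c) (cvgB (cvg_csum aC) (cvg_csum bC)).
Qed.

Lemma csumZ C c a : dominated C a -> csum (fun k => c * a k) = c * csum a.
Proof.
move=> aC; apply: csum_unique.
have -> : series (fun k => c * a k) = fun N => c * series a N.
  by apply/funext => N; rewrite /series/= mulr_sumr.
exact: cvgM (cvg_cst c) (cvg_csum aC).
Qed.

Lemma cnorm_lim_le (T : Type) (F : set_system T) {FF : ProperFilter F}
    (f : T -> cplx R) (l y : cplx R) (e : R) :
  f x @[x --> F] --> l -> (\forall x \near F, cnorm (f x - y) <= e) ->
  cnorm (l - y) <= e.
Proof.
move=> /cvgcP fl fe; apply/ler_addgt0Pr => d d0.
have := fl d d0 => fld.
have [x [x1 x2]] := filter_ex (filterI fld fe).
have -> : l - y = (l - f x) + (f x - y) by ring.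
by apply: le_trans (ler_cnormD _ _) _; rewrite addrC lerD// ltW.
Qed.

Definition majorant_tail (K : nat) : R := limn (series majorant) - series majorant K.

Lemma majorant_tail_cvg : majorant_tail K @[K --> \oo] --> 0.
Proof.
rewrite -(subrr (limn (series majorant))).
by apply: cvgB; [exact: cvg_cst | exact: is_cvg_series_majorant].
Qed.

Lemma majorant_tail_ge0 K : 0 <= majorant_tail K.
Proof.
rewrite subr_ge0; apply: nondecreasing_cvgn_le => //.
  by apply: nondecreasing_series => k _ _; exact/ltW/majorant_gt0.
exact: is_cvg_series_majorant.
Qed.

Lemma csum_tail C a K : 0 <= C -> dominated C a ->
  cnorm (csum a - series a K) <= C * majorant_tail K.
Proof.
move=> C0 aC; apply: (cnorm_lim_le (cvg_csum aC)).
near=> N; have KN : (K <= N)%N by near: N; exact: nbhs_infty_ge.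
rewrite sub_series_geq//; apply: le_trans (ler_cnorm_sum _ _ _) _.
apply: (@le_trans _ _ (\sum_(K <= k < N) (C * majorant k))).
  by apply: ler_sum => k _; exact: aC.
rewrite -mulr_sumr -sub_series_geq// ler_wpM2l// lerD2r -subr_ge0.
exact: majorant_tail_ge0.
Unshelve. all: by end_near. Qed.

Lemma cvg_big_sum (T : Type) (F : set_system T) {FF : Filter F}
    (f : T -> nat -> cplx R) (l : nat -> cplx R) :
  (forall k, f x k @[x --> F] --> l k) ->
  forall K, series (f x) K @[x --> F] --> series l K.
Proof.
move=> fl; elim=> [|K IH].
  have -> : (fun x => series (f x) 0) = fun=> series l 0.
    by apply/funext => x; rewrite /series/= !big_geq.
  exact: cvg_cst.
rewrite seriesSr; under eq_fun do rewrite seriesSr.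
exact: cvgD IH (fl K).
Qed.

(** Stated for an arbitrary proper filter, to serve both [N] tending to infinity and [h] tending to
    0. Domination of the limit is part of the conclusion, since it makes the series of limits
    converge. *)
Lemma tannery (T : Type) (F : set_system T) {FF : ProperFilter F}
    (f : T -> nat -> cplx R) (l : nat -> cplx R) C :
  (\forall x \near F, dominated C (f x)) ->
  (forall k, f x k @[x --> F] --> l k) ->
  dominated C l /\ csum (f x) @[x --> F] --> csum l.
Proof.
move=> fC fl.
have lC : dominated C l.
  move=> k; rewrite -[l k]subr0; apply: cnorm_lim_le (fl k) _.
  by apply: filterS fC => x /(_ k); rewrite subr0.
split=> //.
have C0 : 0 <= C.
  have := le_trans (cnorm_ge0 _) (lC 0%N).
  by rewrite pmulr_lge0// majorant_gt0.
apply/cvgcP => e e0.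
have e30 : 0 < e / 3 by lra.
have [K KC] : exists K, C * majorant_tail K < e / 3.
  have /cvgrPdist_lt : C * majorant_tail K @[K --> \oo] --> C * 0.
    by apply: cvgM; [exact: cvg_cst | exact: majorant_tail_cvg].
  move=> /(_ _ e30) tK; have [K hK] := filter_ex tK.
  exists K; move: hK; rewrite mulr0 sub0r normrN; exact: le_lt_trans (ler_norm _).
have /cvgcP /(_ _ e30) fK := @cvg_big_sum T F (@filter_filter T F FF) f l fl K.
near=> x.
have -> : csum l - csum (f x) = (csum l - series l K) +
    (series l K - series (f x) K) - (csum (f x) - series (f x) K) by ring.
apply: le_lt_trans (ler_cnormD _ _) _; rewrite cnormN.
have h1 := ler_cnormD (csum l - series l K) (series l K - series (f x) K).
have h2 := csum_tail K C0 lC.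
have h3 : cnorm (csum (f x) - series (f x) K) <= C * majorant_tail K.
  by apply: csum_tail => //; near: x.
have h4 : cnorm (series l K - series (f x) K) < e / 3 by near: x.
lra.
Unshelve. all: by end_near. Qed.

End dominated_series.

(** * The complex exponential *)

Section complex_exponential.
Variable R : realType.
Implicit Types (z w : cplx R) (a b x : R).

Lemma cexpD z w : cexp (z + w) = cexp z * cexp w.
Proof.
rewrite /cexp; case: z w => [a b] [c d] /=.
by apply: cplxP => /=; rewrite expRD ?cosD ?sinD; ring.
Qed.

Lemma cnorm_cexp z : cnorm (cexp z) = expR (complex.Re z).
Proof.
rewrite cnorm_sqrt /cexp /= !exprMn -mulrDr cos2Dsin2 mulr1 sqrtr_sqr.
by rewrite ger0_norm// expR_ge0.
Qed.

Lemma cexp_neq0 z : cexp z != 0.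
Proof. by rewrite -cnorm_gt0 cnorm_cexp expR_gt0. Qed.

Lemma sin_norm_le x : `|sin x| <= `|x|.
Proof.
wlog x0 : x / 0 <= x.
  move=> h; have [/h//|/ltW x0] := leP 0 x.
  by have := h (- x); rewrite oppr_ge0 sinN !normrN; apply.
have dsin y : y \in `]0, x[%R -> is_derive y 1 (@sin R) (cos y).
  by move=> _; exact: is_derive_sin.
have csin : {within `[0, x], continuous (@sin R)}.
  by apply: continuous_subspaceT => y; exact: continuous_sin.
have [c _] := MVT_segment x0 dsin csin.
rewrite sin0 !subr0 => ->; rewrite normrM ler_piMl//.
exact: cos_max.
Qed.

Lemma cos_sub1_le x : `|cos x - 1| <= x ^+ 2.
Proof.
have -> : cos x - 1 = - (2 * sin (x / 2) ^+ 2).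
  have {1}-> : x = (x / 2) *+ 2 by rewrite -mulr_natr; field.
  by rewrite cos_mulr2n sin2cos2; ring.
rewrite normrN normrM normrX ger0_norm//.
have := sin_norm_le (x / 2); rewrite normrM [`|2^-1|]ger0_norm// => h.
have -> : x ^+ 2 = `|x| ^+ 2 by rewrite real_normK ?num_real.
by have := normr_ge0 (sin (x / 2)); nra.
Qed.

Lemma sin_subx_le x : `|x| <= 1 -> `|sin x - x| <= x ^+ 2.
Proof.
wlog x0 : x / 0 <= x.
  move=> h; have [/h//|/ltW x0] := leP 0 x.
  have := h (- x); rewrite oppr_ge0 sinN -opprD !normrN sqrrN.
  by apply.
rewrite ger0_norm// => x1.
have df y : y \in `]0, x[%R ->
    is_derive y 1 (fun t : R => sin t - t) (cos y - 1).
  by move=> _; apply: is_deriveB.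
have cf : {within `[0, x], continuous (fun t : R => sin t - t)}.
  apply: continuous_subspaceT => y; apply: cvgB; last exact: cvg_id.
  exact: continuous_sin.
have [c] := MVT_segment x0 df cf.
rewrite in_itv/= => /andP[c0 cx].
rewrite sin0 !subr0 => ->; rewrite normrM (ger0_norm x0) expr2 ler_wpM2r//.
by apply: le_trans (cos_sub1_le _) _; nra.
Qed.

(** Both sides come from [1 + t <= exp t]: at [t = x] from below, at [t = -x] from above through
    [exp x * (1 - x) <= 1]. The restriction [x <= 1/2] is the sign of [1 - 2 x]. *)
Lemma expR_sub1_le x : `|x| <= 2^-1 -> `|expR x - 1 - x| <= 2 * x ^+ 2.
Proof.
rewrite ler_norml => /andP[h1 h2].
have h3 := expR_ge1Dx x; have h4 := expR_ge1Dx (- x).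
have h5 := expR_gt0 x.
have h6 : expR x * expR (- x) = 1 by rewrite expRN divff// gt_eqF.
have h7 : expR x * (1 - x) <= 1 by nra.
have h8 : expR x <= (1 + x + 2 * x ^+ 2).
  suff : 0 <= (1 - x) * (1 + x + 2 * x ^+ 2 - expR x) by rewrite pmulr_rge0; lra.
  suff : 0 <= (1 - x) * (1 + x + 2 * x ^+ 2) - 1 by lra.
  have -> : (1 - x) * (1 + x + 2 * x ^+ 2) - 1 = x ^+ 2 * (1 - 2 * x) by ring.
  by rewrite mulr_ge0 ?sqr_ge0//; lra.
by rewrite ger0_norm; lra.
Qed.

(** The real part contributes [2 + 2] and the imaginary part [2 + 3] times [cnorm z ^+ 2]; the
    constant 11 is not sharp. *)
Lemma cexp_taylor z : cnorm z <= 2^-1 ->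
  cnorm (cexp z - 1 - z) <= 11 * cnorm z ^+ 2.
Proof.
case: z => a b hz; have := ler_Re_cnorm (a +i* b)%C; have := ler_Im_cnorm (a +i* b)%C => /=.
set r := cnorm _ in hz *; move=> hb ha.
have r0 : 0 <= r by exact: cnorm_ge0.
have e1 := @expR_sub1_le a (le_trans ha hz).
have s1 := @sin_subx_le b _; have c1 := cos_sub1_le b.
have a2 : a ^+ 2 <= r ^+ 2 by rewrite -real_normK ?num_real// lerXn2r ?nnegrE.
have b2 : b ^+ 2 <= r ^+ 2 by rewrite -real_normK ?num_real// lerXn2r ?nnegrE.
have {}s1 : `|sin b - b| <= b ^+ 2 by apply: s1; lra.
have ea : expR a <= 2.
  have : expR a - 1 - a <= 2 * a ^+ 2 by apply: le_trans e1; exact: ler_norm.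
  have : a <= r by apply: le_trans ha; exact: ler_norm.
  by nra.
have e0 := expR_gt0 a.
have eb : `|(expR a - 1) * b| <= 3 * r ^+ 2.
  rewrite normrM.
  have : `|expR a - 1| <= 2 * r.
    have -> : expR a - 1 = (expR a - 1 - a) + a by ring.
    apply: le_trans (ler_normD _ _) _; nra.
  by have := normr_ge0 b; have := normr_ge0 (expR a - 1); nra.
apply: le_trans (ler_cnorm_ReIm _) _; rewrite !ReB !ImB /cexp/=.
have -> : expR a * cos b - 1 - a = expR a * (cos b - 1) + (expR a - 1 - a) by ring.
have -> : expR a * sin b - 0 - b = expR a * (sin b - b) + (expR a - 1) * b by ring.
have := ler_normD (expR a * (cos b - 1)) (expR a - 1 - a).
have := ler_normD (expR a * (sin b - b)) ((expR a - 1) * b).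
rewrite ![`|expR a * _|]normrM (ger0_norm (ltW e0)).
have := normr_ge0 (cos b - 1); have := normr_ge0 (sin b - b).
have k1 : expR a * `|cos b - 1| <= 2 * r ^+ 2.
  by apply: ler_pM => //; exact: le_trans c1 b2.
have k2 : expR a * `|sin b - b| <= 2 * r ^+ 2.
  by apply: ler_pM => //; exact: le_trans s1 b2.
by have := sqr_ge0 r; lra.
Qed.

End complex_exponential.

(** * Convergence of Euler's product *)

Section gamma_limit.
Variable R : realType.
Implicit Types (z x s : cplx R) (N k : nat).

Definition nonpole z := forall k, z + k%:R != 0.

(** For large [k], [|z + k| >= k - |z| >= (k+1)/2]; the finitely many other values are nonzero and
    have a minimum. This linear growth supplies the factor [1/(k+1)] in the majorants of the Beta
    terms. *)
Lemma nonpole_bound z : nonpole z ->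
  exists2 c : R, 0 < c & forall k, c * k.+1%:R <= cnorm (z + k%:R).
Proof.
move=> nz; have [K Kz] : exists K, 2 * cnorm z + 1 < K%:R.
  exists (Num.bound (2 * cnorm z + 1)).
  by apply: archi_boundP; have := cnorm_ge0 z; lra.
have [c c0 hc] : exists2 c : R, 0 < c & forall k, (k < K)%N -> c * k.+1%:R <= cnorm (z + k%:R).
  elim: (K) => [|M [c c0 hc]]; first by exists 1.
  have zM : 0 < cnorm (z + M%:R) / M.+1%:R by rewrite divr_gt0// cnorm_gt0.
  exists (Num.min c (cnorm (z + M%:R) / M.+1%:R)); first by rewrite lt_min c0.
  move=> k; rewrite ltnS leq_eqVlt => /predU1P[->|kM].
    by rewrite -ler_pdivlMr// ge_min lexx orbT.
  apply: le_trans (hc k kM); rewrite ler_wpM2r// ge_min lexx//.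
exists (Num.min c 2^-1); first by rewrite lt_min c0/= invr_gt0.
move=> k; have [kK|Kk] := ltnP k K.
  by apply: le_trans (hc k kK); rewrite ler_wpM2r// ge_min lexx.
apply: (@le_trans _ _ (2^-1 * k.+1%:R)).
  by rewrite ler_wpM2r// ge_min lexx orbT.
have : (K%:R : R) <= k%:R by rewrite ler_nat.
have := ler_cnormB k%:R (- z); rewrite opprK cnormN cnorm_nat [k%:R + z]addrC.
by rewrite -[k.+1%:R]natr1; lra.
Qed.

(** A discrete Gronwall inequality, [gb], first bounds the sequence; the increments are then
    dominated, and their series telescopes to the sequence. *)
Lemma multiplicative_cvg (C : R) (g : nat -> cplx R) :
  0 <= C ->
  (forall k, cnorm (g k.+1 - g k) <= C * majorant R k * cnorm (g k)) ->
  exists l : cplx R, g N @[N --> \oo] --> l.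
Proof.
move=> C0 gC.
have gb N : cnorm (g N) <= cnorm (g 0%N) * expR (C * series (majorant R) N).
  elim: N => [|N IH]; first by rewrite /series/= big_geq// mulr0 expR0 mulr1.
  have h1 : cnorm (g N.+1) <= (1 + C * majorant R N) * cnorm (g N).
    have := ler_cnormB (g N.+1) (g N); have := gC N; lra.
  apply: (le_trans h1); rewrite seriesSr mulrDr expRD mulrA mulrC.
  by apply: ler_pM => //; rewrite ?cnorm_ge0 ?expR_ge1Dx// addr_ge0// mulr_ge0//
    ltW// majorant_gt0.
pose G := cnorm (g 0%N) * expR (C * 2).
have gG N : cnorm (g N) <= G.
  apply: le_trans (gb N) _; rewrite ler_wpM2l ?cnorm_ge0// ler_expR ler_wpM2l//.
  by rewrite series_majorant; have := wallis_gt0 R N; lra.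
have dom : dominated (C * G) (fun k => g k.+1 - g k).
  move=> k; apply: le_trans (gC k) _; rewrite mulrAC ler_wpM2r//.
    exact/ltW/majorant_gt0.
  by rewrite ler_wpM2l.
exists (g 0%N + csum (fun k => g k.+1 - g k)).
have : g 0%N + series (fun k => g k.+1 - g k) N @[N --> \oo] -->
    g 0%N + csum (fun k => g k.+1 - g k).
  exact: cvgD (cvg_cst (g 0%N)) (cvg_csum dom).
have -> // : (fun N => g 0%N + series (fun k => g k.+1 - g k) N) = g.
by apply/funext => N; rewrite /series/= telescope_sumr// addrC subrK.
Qed.

(** The second relative bound puts the sequence of inverses under [multiplicative_cvg] as well. The
    two limits have product 1, so neither is 0. *)
Lemma multiplicative_cvg_neq0 (C : R) (g : nat -> cplx R) :
  0 <= C -> (forall k, g k != 0) ->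
  (forall k, cnorm (g k.+1 - g k) <= C * majorant R k * cnorm (g k)) ->
  (forall k, cnorm (g k.+1 - g k) <= C * majorant R k * cnorm (g k.+1)) ->
  exists2 l : cplx R, l != 0 & g N @[N --> \oo] --> l.
Proof.
move=> C0 g0 gC gC'; have [l gl] := multiplicative_cvg C0 gC.
have [l' gl'] : exists l : cplx R, (g N)^-1 @[N --> \oo] --> l.
  apply: (@multiplicative_cvg C) => // k.
  have -> : (g k.+1)^-1 - (g k)^-1 = - ((g k.+1 - g k) / (g k.+1 * g k)).
    by have := g0 k; have := g0 k.+1 => *; field; apply/andP.
  rewrite cnormN cnormM !cnormV cnormM invfM mulrA ler_wpM2r ?invr_ge0 ?cnorm_ge0//.
  by rewrite ler_pdivrMr ?cnorm_gt0.
exists l => //; apply/eqP => l0.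
have : (g N * (g N)^-1) @[N --> \oo] --> l * l' by exact: cvgM gl gl'.
have -> : (fun N => g N * (g N)^-1) = fun=> 1.
  by apply/funext => N; rewrite divff.
move/(cvg_lim (@norm_hausdorff _ _)); rewrite lim_cst; last exact: norm_hausdorff.
by move/eqP; rewrite l0 mul0r oner_eq0.
Qed.

Definition gamma_seq z N : cplx R :=
  N`!%:R * natpowC N z / \prod_(j < N.+1) (z + j%:R).

Lemma gamma_seqS z N : nonpole z ->
  gamma_seq z N.+1 = gamma_seq z N *
   (N.+1%:R * cexp (z * (ln N.+1%:R - ln N%:R)%:C%C) / (z + N.+1%:R)).
Proof.
move=> nz; rewrite /gamma_seq big_ord_recr/= factS natrM invfM.
rewrite /natpowC -{1}(subrK (ln N%:R) (ln N.+1%:R)) [X in cexp (z * X)]rmorphD/=.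
by rewrite mulrDr cexpD; set P := (\prod_(i < _) _)^-1; ring.
Qed.

Lemma gamma_seq_neq0 z N : nonpole z -> gamma_seq z N != 0.
Proof.
move=> nz; have f0 : N`!%:R != 0 :> cplx R by rewrite pnatr_eq0 -lt0n fact_gt0.
have p0 : \prod_(j < N.+1) (z + j%:R) != 0 by apply/prodf_neq0 => j _.
by rewrite /gamma_seq !mulf_eq0 invr_eq0 !negb_or f0 p0 cexp_neq0.
Qed.

Lemma ln_succ_bounds N : (0 < N)%N ->
  (N.+1%:R : R)^-1 <= ln (N.+1%:R : R) - ln N%:R <= (N%:R)^-1.
Proof.
move=> N0; have N0' : (0 : R) < N%:R by rewrite ltr0n.
have N1' : (0 : R) < N.+1%:R by rewrite ltr0n.
rewrite -lnV ?posrE// -lnM ?posrE ?invr_gt0//; apply/andP; split.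
  rewrite -[leRHS]opprK -lnV ?posrE ?divr_gt0// invf_div lerNr.
  have -> : N%:R / N.+1%:R = 1 + - N.+1%:R^-1 :> R.
    by rewrite -natr1; field; rewrite natr1 gt_eqF.
  by apply: le_ln1Dx; rewrite ltrN2 invf_lt1// ltr1n ltnS.
have -> : N.+1%:R / N%:R = 1 + N%:R^-1 :> R.
  by rewrite -natr1; field; rewrite gt_eqF.
apply: le_ln1Dx; apply: (@lt_trans _ _ 0) => //.
by rewrite invr_gt0.
Qed.

(** The ratio of consecutive terms differs from 1 by [O(1/M^2)]: in the numerator [z] nearly cancels
    the first-order part of the exponential, as [ln (M+1) - ln M] is close to [1/(M+1)]. The size of
    [M] keeps the exponent within [cexp_taylor] and the denominator above [M/2]. *)
Lemma gamma_seq_step z (M : nat) : nonpole z -> 2 * cnorm z + 1 < M%:R ->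
  let D := cnorm (gamma_seq z M.+1 - gamma_seq z M) in
  let K := 2 * (22 * cnorm z ^+ 2 + cnorm z) / M%:R ^+ 2 in
  D <= K * cnorm (gamma_seq z M) /\ D <= K * (3 * cnorm (gamma_seq z M.+1)).
Proof.
move=> nz Mz /=.
have z0 := cnorm_ge0 z; set r := cnorm z in Mz z0 *.
have M0 : (0 < M)%N by rewrite -(ltr0n R); lra.
have /andP[L1 L2] := ln_succ_bounds M0.
rewrite gamma_seqS//; move: (gamma_seq z M) => g.
set L := ln _ - _ in L1 L2 *; set w := z * _.
have nM1 : z + M.+1%:R != 0 by [].
set m : R := M%:R in Mz L2 *; have m1 : 1 < m by lra.
have M1E : M.+1%:R = m + 1 :> R by rewrite natr1.
rewrite M1E in L1.
have Lm : L * m <= 1 by rewrite -ler_pdivlMr ?div1r//; lra.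
have Lm1 : 1 <= L * (m + 1) by rewrite -ler_pdivrMr ?div1r//; lra.
have L0 : 0 < L by nra.
have wE : cnorm w = r * L by rewrite cnormM cnorm_real ger0_norm// ltW.
have w2 : cnorm w <= 2^-1 by rewrite wE; nra.
have tay := cexp_taylor w2.
have ew : 2^-1 <= cnorm (cexp w).
  rewrite cnorm_cexp; apply: le_trans (expR_ge1Dx _).
  by have := le_trans (ler_Re_cnorm w) w2; rewrite ler_norml; lra.
have zM : m / 2 <= cnorm (z + M.+1%:R).
  have := ler_cnormB M.+1%:R (- z); rewrite opprK cnormN cnorm_nat [_ + z]addrC M1E.
  by rewrite -/r; lra.
have zM' : cnorm (z + M.+1%:R) <= 3 / 2 * (m + 1).
  by have := ler_cnormD z M.+1%:R; rewrite cnorm_nat M1E -/r; lra.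
set E := cexp w in tay ew *.
have dE : g * (M.+1%:R * E / (z + M.+1%:R)) - g =
    g * ((M.+1%:R * (E - 1 - w) + z * (L * (m + 1) - 1)%:C%C) / (z + M.+1%:R)).
  rewrite rmorphB rmorphM/= -M1E -natrC /w; field.
  by rewrite nat1r.
have num : cnorm (M.+1%:R * (E - 1 - w) + z * (L * (m + 1) - 1)%:C%C) <=
    (22 * r ^+ 2 + r) / m.
  apply: le_trans (ler_cnormD _ _) _.
  rewrite !cnormM cnorm_nat cnorm_real M1E ger0_norm -/r ?subr_ge0//.
  rewrite ler_pdivlMr; last lra.
  (* The 22 is twice the 11 of [cexp_taylor], by [m + 1 <= 2 m]. *)
  have t1 : (m + 1) * cnorm (E - 1 - w) * m <= 22 * r ^+ 2.
    have t2 : cnorm (E - 1 - w) * m ^+ 2 <= 11 * r ^+ 2.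
      apply: (@le_trans _ _ (11 * cnorm w ^+ 2 * m ^+ 2)).
        by rewrite ler_wpM2r ?sqr_ge0.
      rewrite wE -mulrA -exprMn -mulrA ler_wpM2l// exprMn ler_piMr ?sqr_ge0//.
      by rewrite exprn_ile1// mulr_ge0//; lra.
    have := cnorm_ge0 (E - 1 - w); move: (cnorm (E - 1 - w)) t2 => q t2 q0.
    have : q * m * (m - 1) >= 0 by rewrite !mulr_ge0//; lra.
    by lra.
  have t3 : (L * (m + 1) - 1) * m <= 1 by nra.
  have : r * ((L * (m + 1) - 1) * m) <= r * 1 by rewrite ler_wpM2l.
  lra.
set D := cnorm _.
have D1 : D <= 2 * (22 * r ^+ 2 + r) / m ^+ 2 * cnorm g.
  rewrite /D dE !cnormM cnormV mulrC ler_wpM2r ?cnorm_ge0//.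
  rewrite ler_pdivrMr; last by lra.
  apply: (le_trans num).
  have -> : (22 * r ^+ 2 + r) / m = 2 * (22 * r ^+ 2 + r) / m ^+ 2 * (m / 2).
    by field; lra.
  rewrite ler_wpM2l// divr_ge0 ?sqr_ge0// mulr_ge0// addr_ge0// mulr_ge0//.
  exact: sqr_ge0.
split=> //; apply: (le_trans D1).
(* The factor 3: consecutive norms have ratio at least [1/3], from [|E| >= 1/2] and
   [|z + M + 1| <= 3/2 (m + 1)]. *)
rewrite ler_wpM2l//.
  rewrite divr_ge0 ?sqr_ge0// mulr_ge0// addr_ge0// mulr_ge0//.
  exact: sqr_ge0.
rewrite !cnormM cnormV cnorm_nat M1E mulrCA ler_peMr ?cnorm_ge0//.
rewrite mulrA ler_pdivlMr ?mul1r; last by lra.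
by apply: le_trans zM' _; nra.
Qed.

Lemma gamma_cvg_neq0 z : nonpole z ->
  gamma_seq z N @[N --> \oo] --> Gamma z /\ Gamma z != 0.
Proof.
move=> nz; have [M Mz] : exists M, 2 * cnorm z + 1 < M%:R.
  exists (Num.bound (2 * cnorm z + 1)).
  by apply: archi_boundP; have := cnorm_ge0 z; lra.
have M0 : (0 < M)%N by rewrite -(ltr0n R); have := cnorm_ge0 z; lra.
have [A A0 AE] : exists2 A : R, 0 <= A & 2 * (22 * cnorm z ^+ 2 + cnorm z) = A.
  exists (2 * (22 * cnorm z ^+ 2 + cnorm z)) => //.
  by rewrite mulr_ge0// addr_ge0 ?cnorm_ge0// mulr_ge0// sqr_ge0.
(* The shift by [M] enters the range of [gamma_seq_step]. The 6 is the 3 of that lemma times the 2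
   of [inv_sqr_le_majorant]. *)
have step k : let D := cnorm (gamma_seq z (k.+1 + M) - gamma_seq z (k + M)) in
    D <= 6 * A * majorant R k * cnorm (gamma_seq z (k + M)) /\
    D <= 6 * A * majorant R k * cnorm (gamma_seq z (k.+1 + M)).
  have kMz : 2 * cnorm z + 1 < (k + M)%:R.
    by apply: lt_le_trans Mz _; rewrite ler_nat leq_addl.
  have [] := gamma_seq_step nz kMz; rewrite addSn AE /=.
  have Ak : A / (k + M)%:R ^+ 2 <= 2 * A * majorant R k.
    rewrite [2 * A]mulrC -mulrA ler_wpM2l//; apply: le_trans (inv_sqr_le_majorant R k).
    rewrite -exprVn lerXn2r ?nnegrE ?invr_ge0// lef_pV2 ?posrE ?ltr0n ?addn_gt0 ?M0 ?orbT//.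
    by rewrite ler_nat -addn1 leq_add2l.
  move: (majorant R k) (majorant_gt0 R k) Ak => q q0 Ak h1 h2.
  have Aq : 0 <= A * q by rewrite mulr_ge0// ltW.
  split.
    apply: (le_trans h1); rewrite ler_wpM2r ?cnorm_ge0//; lra.
  apply: (le_trans h2); rewrite mulrA ler_wpM2r ?cnorm_ge0//; lra.
have [||||l l0 gl] := @multiplicative_cvg_neq0 (6 * A) (fun k => gamma_seq z (k + M)).
- by rewrite mulr_ge0.
- by move=> k; exact: gamma_seq_neq0.
- by move=> k; have [] := step k.
- by move=> k; have [] := step k.
have {}gl : gamma_seq z N @[N --> \oo] --> l.
  by rewrite -(cvg_shiftn M).
have -> : Gamma z = l by apply: cvg_lim gl; exact: norm_hausdorff.
by split.
Qed.

Definition beta_seq x s N : cplx R :=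
  N`!%:R * \prod_(j < N.+1) ((x + s + 1 + j%:R) / ((x + 1 + j%:R) * (s + j%:R))).

(* At a pole the denominators vanish for large N, and x / 0 = 0. *)
Lemma Gamma_pole z j : z + j%:R = 0 -> Gamma z = 0.
Proof.
move=> zj; apply: cvg_lim; first exact: norm_hausdorff.
apply: cvg_near_cst; near=> N.
have jN : (j < N.+1)%N by rewrite ltnS; near: N; exact: nbhs_infty_ge.
by rewrite (bigD1 (Ordinal jN))//= zj mul0r invr0 mulr0.
Unshelve. all: by end_near. Qed.

(** In the quotient of the three Euler sequences the powers of [N] cancel and one factorial
    remains. *)
Lemma beta_seq_cvg x s : nonpole (x + 1) -> nonpole s ->
  beta_seq x s N @[N --> \oo] --> Gamma (x + 1) * Gamma s / Gamma (x + s + 1).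
Proof.
move=> nx ns; have [nxs|] := pselect (nonpole (x + s + 1)); last first.
  (* At a pole of [Gamma (x + s + 1)] the default values still give the true one: the limit is 0
     because division by 0 gives 0, and the product eventually contains the factor
     [x + s + 1 + j = 0]. *)
  move=> /existsNP[j /negP]; rewrite negbK => /eqP xsj.
  rewrite (Gamma_pole xsj) invr0 mulr0.
  apply: cvg_near_cst; near=> N.
  have jN : (j < N.+1)%N by rewrite ltnS; near: N; exact: nbhs_infty_ge.
  by rewrite /beta_seq (bigD1 (Ordinal jN))//= xsj !mul0r mulr0.
have -> : beta_seq x s = fun N =>
    gamma_seq (x + 1) N * gamma_seq s N / gamma_seq (x + s + 1) N.
  apply/funext => N; rewrite /beta_seq /gamma_seq.
  have -> : natpowC N (x + s + 1) = natpowC N (x + 1) * natpowC N s.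
    by rewrite /natpowC -cexpD; congr cexp; ring.
  rewrite prodf_div big_split/= ; set P := \prod_(i < N.+1) (x + s + 1 + i%:R).
  set Q := \prod_(i < _) (x + 1 + _); set S := \prod_(i < _) (s + _).
  have P0 : P != 0 by apply/prodf_neq0 => j _.
  have Q0 : Q != 0 by apply/prodf_neq0 => j _.
  have S0 : S != 0 by apply/prodf_neq0 => j _.
  have f0 : N`!%:R != 0 :> cplx R by rewrite pnatr_eq0 -lt0n fact_gt0.
  have e1 : natpowC N (x + 1) != 0 by exact: cexp_neq0.
  have e2 : natpowC N s != 0 by exact: cexp_neq0.
  by field; rewrite P0 Q0 S0 f0 e1 e2.
have [c1 _] := gamma_cvg_neq0 nx.
have [c2 _] := gamma_cvg_neq0 ns.
have [c3 n3] := gamma_cvg_neq0 nxs.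
exact: cvgM (cvgM c1 c2) (cvgV n3 c3).
Unshelve. all: by end_near. Qed.

End gamma_limit.

(** * Partial fractions of the finite Beta product *)

Section beta_partial_fractions.
Variable R : realType.
Implicit Types (z x s : cplx R) (N k n : nat).

(* (-1)^k times the generalised binomial coefficient x choose k *)
Definition sbin x k : cplx R := \prod_(i < k) ((i%:R - x) / i.+1%:R).

Lemma sbinS x k : sbin x k.+1 = sbin x k * ((k%:R - x) / k.+1%:R).
Proof. by rewrite /sbin big_ord_recr. Qed.

(** The coefficient of [1/(s + k)] in [beta_seq x s N], written as [sbin x k] with a correction
    [(N - i)/(x + N + 1 - i)] on each factor. It is 0 for [k > N], so the finite expansion is also a
    [csum]. *)
Definition beta_coef x N k : cplx R :=
  \prod_(i < k) ((N%:R - i%:R) / (x + N.+1%:R - i%:R) * ((i%:R - x) / i.+1%:R)).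

Lemma beta_coefS x N k : beta_coef x N k.+1 = beta_coef x N k *
  ((N%:R - k%:R) / (x + N.+1%:R - k%:R) * ((k%:R - x) / k.+1%:R)).
Proof. by rewrite /beta_coef big_ord_recr. Qed.

Lemma natr_neq0 k : (k.+1%:R : cplx R) != 0.
Proof. by rewrite pnatr_eq0. Qed.

Lemma nonpole_sub x N k : nonpole (x + 1) -> (k <= N)%N ->
  x + N.+1%:R - k%:R != 0.
Proof.
move=> nx kN; have := nx (N - k)%N; rewrite natrB// -natr1.
by congr (_ != _); ring.
Qed.

(** Passing to [N + 1] multiplies the product by [(N+1)(x+s+N+2)/((x+N+2)(s+N+1))]; the identity is
    this factor at [s = -k], cross-multiplied. *)
Lemma beta_coef_recN x N k : nonpole (x + 1) -> (k <= N.+1)%N ->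
  beta_coef x N.+1 k * (x + N.+2%:R) * (N.+1%:R - k%:R) =
  beta_coef x N k * N.+1%:R * (x + N.+2%:R - k%:R).
Proof.
move=> nx; elim: k => [|k IH] kN.
  by rewrite /beta_coef !big_ord0; ring.
have n1 := nonpole_sub nx (ltnW kN); have n2 := nonpole_sub nx (kN : (k <= N)%N).
have n3 := natr_neq0 k.
rewrite !beta_coefS.
transitivity (beta_coef x N.+1 k * (x + N.+2%:R) * (N.+1%:R - k%:R) *
  ((N.+1%:R - k.+1%:R) * ((k%:R - x) / k.+1%:R) / (x + N.+2%:R - k%:R))).
  by ring.
rewrite (IH (ltnW kN)).
transitivity (beta_coef x N k * N.+1%:R * (N.+1%:R - k.+1%:R) * ((k%:R - x) / k.+1%:R)).
  set a := x + N.+2%:R - k%:R; set b := (k%:R - x) / _.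
  have : a / a = 1 by rewrite divff.
  by move=> aa; rewrite -[RHS]mulr1 -aa; ring.
have -> : x + N.+2%:R - k.+1%:R = x + N.+1%:R - k%:R.
  by rewrite -[N.+2%:R]natr1 -[k.+1%:R]natr1; ring.
have -> : N.+1%:R - k.+1%:R = N%:R - k%:R :> cplx R.
  by rewrite -[N.+1%:R]natr1 -[k.+1%:R]natr1; ring.
set a := x + N.+1%:R - k%:R; set b := (k%:R - x) / _.
have : a / a = 1 by rewrite divff.
by move=> aa; rewrite -[LHS]mulr1 -aa; ring.
Qed.

Lemma prod_subn M : \prod_(i < M) (M%:R - i%:R : cplx R) = M`!%:R.
Proof.
elim: M => [|M IH]; first by rewrite big_ord0.
rewrite big_ord_recl/= subr0 factS natrM -IH; congr (_ * _).
apply: eq_bigr => i _; rewrite /bump/= add1n -[M.+1%:R]natr1 -[i.+1%:R]natr1.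
by ring.
Qed.

(** The coefficient at the new pole [s = -(N+1)] is the old product evaluated there times the
    residue of the new factor. Reversing the factors turns the numerators into [x - i] and the
    [s + j] into [-(i+1)]. *)
Lemma beta_coef_diag x N : nonpole (x + 1) ->
  N.+1%:R * (x + 1) / (x + N.+2%:R) * beta_seq x (- N.+1%:R) N =
  beta_coef x N.+1 N.+1.
Proof.
move=> nx.
have bE : beta_seq x (- N.+1%:R) N = N`!%:R * (\prod_(i < N.+1) ((i%:R - x) / i.+1%:R)
    / \prod_(i < N.+1) (x + N.+1%:R - i%:R)).
  rewrite /beta_seq; congr (_ * _).
  rewrite (reindex_inj rev_ord_inj)/= -prodf_div; apply: eq_bigr => i _.
  have iN : (i <= N)%N by rewrite -ltnS.
  rewrite subSS natrB//.
  have -> : x - N.+1%:R + 1 + (N%:R - i%:R) = x - i%:R by rewrite -natr1; ring.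
  have -> : - N.+1%:R + (N%:R - i%:R) = - i.+1%:R :> cplx R by rewrite -!natr1; ring.
  have -> : x + 1 + (N%:R - i%:R) = x + N.+1%:R - i%:R by rewrite -natr1; ring.
  by rewrite mulrN invrN invfM; ring.
(* Both sides are [(x+1)(x+2)...(x+N+2)]. *)
have split2 : (x + N.+2%:R) * \prod_(i < N.+1) (x + N.+1%:R - i%:R) =
    (x + 1) * \prod_(i < N.+1) (x + N.+2%:R - i%:R).
  transitivity (\prod_(i < N.+2) (x + N.+2%:R - i%:R)).
    rewrite [RHS]big_ord_recl/= subr0; congr (_ * _); apply: eq_bigr => i _.
    by rewrite /bump/= add1n -[N.+2%:R]natr1 -[i.+1%:R]natr1; ring.
  rewrite [LHS]big_ord_recr/= mulrC; congr (_ * _).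
  by rewrite -[N.+2%:R]natr1; ring.
rewrite bE /beta_coef [RHS]big_split/=.
have -> : \prod_(i < N.+1) ((N.+1%:R - i%:R) / (x + N.+2%:R - i%:R)) =
    N.+1`!%:R / \prod_(i < N.+1) (x + N.+2%:R - i%:R).
  by rewrite -prod_subn -prodf_div.
rewrite factS natrM.
set P := \prod_(i < N.+1) ((i%:R - x) / _).
move: split2; set Q := \prod_(i < _) (x + N.+1%:R - _).
set S := \prod_(i < _) (x + N.+2%:R - _) => QS.
have Q0 : Q != 0 by apply/prodf_neq0 => i _; apply: nonpole_sub => //; rewrite -ltnS.
have S0 : S != 0 by apply/prodf_neq0 => i _; apply: nonpole_sub => //; rewrite ltnW// ltnS.
have x20 : x + N.+2%:R != 0 by have := nonpole_sub nx (leq0n N.+1); rewrite subr0.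
have xQS : (x + 1) / (x + N.+2%:R) = Q / S.
  by apply/eqP; rewrite eqr_div// -QS mulrC.
transitivity (N.+1%:R * ((x + 1) / (x + N.+2%:R)) * (N`!%:R * (P / Q))).
  by ring.
rewrite xQS; transitivity (N.+1%:R * N`!%:R / S * P * (Q / Q)); first by ring.
by rewrite divff// mulr1.
Qed.

Definition beta_const x N : cplx R := N`!%:R / \prod_(j < N.+1) (x + 1 + j%:R).

Lemma beta_seq_partial_fractions x s N : nonpole (x + 1) ->
  (forall j, (j <= N)%N -> s + j%:R != 0) ->
  beta_seq x s N = beta_const x N + \sum_(k < N.+1) beta_coef x N k / (s + k%:R).
Proof.
move=> nx; elim: N s => [|N IH] s ns.
  rewrite /beta_seq /beta_const big_ord1 !big_ord_recr !big_ord0/= /beta_coef !big_ord0.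
  have := nx 0%N; have := ns 0%N isT; rewrite !addr0 => s0 x0.
  by rewrite fact0; field; apply/andP.
have nd (k : 'I_N.+1) : k%:R - N.+1%:R != 0 :> cplx R.
  by rewrite subr_eq0 eqr_nat neq_ltn ltn_ord.
have x20 : x + N.+2%:R != 0 by have := nonpole_sub nx (leq0n N.+1); rewrite subr0.
have sN : s + N.+1%:R != 0 by exact: ns.
(* The induction hypothesis is used a second time, at the new pole itself: it expresses the new
   coefficient through the old ones, in exactly the form left over when each [1/((s+k)(s+N+1))] is
   split. *)
have diag := beta_coef_diag N nx.
rewrite IH in diag; last first.
  move=> j jN; rewrite addrC subr_eq0 eqr_nat neq_ltn ltnS jN//.
have -> : beta_seq x s N.+1 = N.+1%:R / (x + N.+2%:R) *
    ((x + s + N.+2%:R) / (s + N.+1%:R)) * beta_seq x s N.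
  rewrite /beta_seq big_ord_recr/= factS natrM !invfM.
  have -> : x + s + 1 + N.+1%:R = x + s + N.+2%:R by rewrite -[N.+2%:R]natr1; ring.
  have -> : x + 1 + N.+1%:R = x + N.+2%:R by rewrite -[N.+2%:R]natr1; ring.
  by ring.
rewrite IH; last by move=> j jN; apply: ns; exact: ltnW.
rewrite [X in _ = _ + X]big_ord_recr/= -diag.
have -> : beta_const x N.+1 = N.+1%:R / (x + N.+2%:R) * beta_const x N.
  rewrite /beta_const big_ord_recr/= factS natrM invfM.
  have -> : x + 1 + N.+1%:R = x + N.+2%:R by rewrite -[N.+2%:R]natr1; ring.
  by ring.
set rho := N.+1%:R / (x + N.+2%:R).
have -> : \sum_(k < N.+1) beta_coef x N.+1 k / (s + k%:R) =
  \sum_(k < N.+1) (rho * ((x + s + N.+2%:R) / (s + N.+1%:R)) * (beta_coef x N k / (s + k%:R))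
     - rho * (x + 1) / (s + N.+1%:R) * (beta_coef x N k / (- N.+1%:R + k%:R))).
  apply: eq_bigr => k _.
  have kN : (k <= N.+1)%N by exact/ltnW/ltn_ord.
  have rec := beta_coef_recN nx kN.
  have sk : s + k%:R != 0 by exact: ns.
  have nk := nd k.
  have nk' : N.+1%:R - k%:R != 0 :> cplx R by rewrite -opprB oppr_eq0.
  have -> : beta_coef x N.+1 k =
     beta_coef x N k * N.+1%:R * (x + N.+2%:R - k%:R) / ((x + N.+2%:R) * (N.+1%:R - k%:R)).
    by apply: (canRL (mulfK _)); rewrite ?mulf_neq0// mulrA.
  rewrite /rho; move: nk nk' x20 sN; rewrite -[N.+2%:R]natr1.
  move: (N.+1%:R : cplx R) (k%:R : cplx R) (beta_coef x N k) sk => M kk b sk nk nk' xM sM.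
  by field; rewrite [- M + kk]addrC sk nk nk' xM sM.
rewrite sumrB -!mulr_sumr.
have -> : (x + s + N.+2%:R) / (s + N.+1%:R) = 1 + (x + 1) / (s + N.+1%:R).
  by rewrite -[N.+2%:R]natr1; move: (N.+1%:R : cplx R) sN => M sN; field.
have -> : N.+1%:R * (x + 1) / (x + N.+2%:R) = rho * (x + 1) by rewrite /rho; ring.
by ring.
Qed.

End beta_partial_fractions.

(** * The Beta quotient as a series *)

Section beta_series.
Variable R : realType.
Implicit Types (z x s : cplx R) (N k n : nat).

Lemma Re_ball x n : cnorm (x - n%:R) <= 2^-1 -> - 2^-1 <= complex.Re x.
Proof.
move=> xn; have := le_trans (ler_Re_cnorm _) xn; rewrite ReB Re_nat ler_norml.
by have : (0 : R) <= n%:R by []; lra.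
Qed.

Lemma Re_le_cnorm z : complex.Re z <= cnorm z.
Proof. exact: le_trans (ler_norm _) (ler_Re_cnorm z). Qed.

Lemma nonpole_Re x : - 2^-1 <= complex.Re x -> nonpole (x + 1).
Proof.
move=> hx k; rewrite -cnorm_gt0; apply: lt_le_trans (Re_le_cnorm _).
by rewrite !ReD Re_nat /=; have : (0 : R) <= k%:R by []; lra.
Qed.

(** Here [|k - x| <= |k - n| + 1/2]. For [k >= n] this is at most [k + 1/2], the numerator in
    [wallis]; each of the first [n] factors costs at most [2n + 1], and [minn k n] counts them. *)
Lemma sbin_le n x k : cnorm (x - n%:R) <= 2^-1 ->
  cnorm (sbin x k) <= (2 * n%:R + 1) ^+ n * wallis R k.
Proof.
move=> xn; have n0 : (0 : R) <= n%:R by [].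
suff h : cnorm (sbin x k) <= (2 * n%:R + 1) ^+ minn k n * wallis R k.
  apply: le_trans h _; apply: ler_wpM2r; first exact/ltW/wallis_gt0.
  by apply: ler_weXn2l; rewrite ?geq_minr//; lra.
elim: k => [|k IH].
  by rewrite /sbin big_ord0 cnorm1 min0n expr0 mul1r wallis0.
rewrite sbinS wallisS cnormM cnormM cnormV cnorm_nat !mulrA.
rewrite ler_wpM2r ?invr_ge0//.
have kx : cnorm (k%:R - x) <= `|k%:R - n%:R| + 2^-1.
  have -> : k%:R - x = (k%:R - n%:R) - (x - n%:R) by ring.
  apply: le_trans (ler_cnormD _ _) _; rewrite cnormN lerD//.
  by rewrite !natrC -rmorphB/= cnorm_real.
have w0 := wallis_gt0 R k; have k0 : (0 : R) <= k%:R by [].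
have [nk|kn] := leqP n k.
  rewrite (minn_idPr nk) in IH; rewrite (minn_idPr (leqW nk)).
  apply: ler_pM => //; rewrite ?cnorm_ge0//.
  apply: le_trans kx _; rewrite ger0_norm ?subr_ge0 ?ler_nat//; lra.
rewrite (minn_idPl (ltnW kn)) in IH; rewrite (minn_idPl kn) exprS.
rewrite [leRHS](_ : _ = (2 * n%:R + 1) ^+ k * wallis R k *
  ((2 * n%:R + 1) * (k%:R + 2^-1))); last by ring.
apply: ler_pM => //; rewrite ?cnorm_ge0//.
apply: le_trans kx _; rewrite ler0_norm ?subr_le0 ?ler_nat ?(ltnW kn)//.
by nra.
Qed.

(** Each correction factor has norm at most 1, its denominator having real part at least
    [N - i + 1/2]. *)
Lemma beta_coef_le x N k : - 2^-1 <= complex.Re x ->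
  cnorm (beta_coef x N k) <= cnorm (sbin x k).
Proof.
move=> hx; have [kN|Nk] := leqP k N; last first.
  by rewrite /beta_coef (bigD1 (Ordinal Nk))//= subrr !mul0r cnorm0 cnorm_ge0.
rewrite /beta_coef /sbin !cnorm_prod; apply: ler_prod => i _.
rewrite cnorm_ge0 cnormM ler_piMl ?cnorm_ge0// cnormM cnormV.
have iN : (i <= N)%N by apply: ltnW; apply: leq_trans kN.
have d0 : 0 < cnorm (x + N.+1%:R - i%:R).
  by rewrite cnorm_gt0; apply: nonpole_sub => //; exact: nonpole_Re.
rewrite ler_pdivrMr// mul1r -natrB// cnorm_nat.
apply: le_trans (Re_le_cnorm _); rewrite ReB ReD !Re_nat natrB// -natr1; lra.
Qed.

Lemma inv_nat_shift_cvg z (c : cplx R) :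
  (N%:R - c) / (z + N.+1%:R - c) @[N --> \oo] --> (1 : cplx R).
Proof.
apply/cvgcP => e e0.
near=> N.
have hN : (cnorm (z + 1) / e + cnorm (z + 1 - c)) < N%:R.
  by near: N; exact: nbhs_infty_gtr.
have d : cnorm (z + 1) / e < cnorm (z + N.+1%:R - c).
  have := ler_cnormB N%:R (- (z + 1 - c)).
  rewrite cnorm_nat cnormN opprK.
  have -> : N%:R + (z + 1 - c) = z + N.+1%:R - c by rewrite -natr1; ring.
  by lra.
have d0 : 0 < cnorm (z + N.+1%:R - c).
  by apply: le_lt_trans d; rewrite divr_ge0 ?cnorm_ge0// ltW.
have -> : 1 - (N%:R - c) / (z + N.+1%:R - c) = (z + 1) / (z + N.+1%:R - c).
  move: d0; rewrite cnorm_gt0 -natr1 => d0; field.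
  by move: d0; congr (_ != _); ring.
by rewrite cnormM cnormV ltr_pdivrMr// mulrC -ltr_pdivrMr.
Unshelve. all: by end_near. Qed.

Lemma beta_coef_cvg x k :
  beta_coef x N k @[N --> \oo] --> sbin x k.
Proof.
elim: k => [|k IH].
  rewrite /sbin big_ord0.
  have -> : (fun N => beta_coef x N 0) = fun=> 1.
    by apply/funext => N; rewrite /beta_coef big_ord0.
  exact: cvg_cst.
rewrite sbinS -[X in sbin x k * X]mul1r.
under eq_fun do rewrite beta_coefS.
exact: cvgM IH (cvgM (@inv_nat_shift_cvg x k%:R) (cvg_cst _)).
Qed.

(** The lower Wallis estimate [wallis k >= 1/(2 sqrt k)] for [k >= 1], squared to avoid roots; it is
    an equality at [k = 1]. *)
Lemma wallis_lower k : k.+1%:R <= 4 * (k.+1%:R * wallis R k.+1) ^+ 2.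
Proof.
elim: k => [|k IH].
  by rewrite wallisS wallis0 /= mul1r invr1 mulr1 add0r; lra.
rewrite wallisS; set w := wallis R k.+1 in IH *.
rewrite -[k.+2%:R]natr1; have : (1 : R) <= k.+1%:R by rewrite ler1n.
move: (k.+1%:R : R) IH => y IH y1.
have -> : (y + 1) * (w * ((y + 2^-1) / (y + 1))) = w * (y + 2^-1) by field; lra.
have : y * (y + 2^-1) ^+ 2 <= 4 * (w * (y + 2^-1)) ^+ 2 * y ^+ 2.
  have -> : 4 * (w * (y + 2^-1)) ^+ 2 * y ^+ 2 = 4 * (y * w) ^+ 2 * (y + 2^-1) ^+ 2 by ring.
  by rewrite ler_wpM2r// sqr_ge0.
have : y ^+ 2 * (y + 1) <= y * (y + 2^-1) ^+ 2.
  have -> : y * (y + 2^-1) ^+ 2 = y ^+ 2 * (y + 1) + y / 4 by field.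
  by rewrite lerDl divr_ge0//; lra.
move=> h1 h2; have := le_trans h1 h2.
by rewrite [leRHS]mulrC ler_pM2l// exprn_gt0//; lra.
Qed.

(** Comparing [|x + 1 + j|] with [j + 1/2] bounds the constant by [1/((N+1) wallis (N+1))], which is
    at most [2/sqrt(N+1)] by [wallis_lower]. *)
Lemma beta_const_cvg x : - 2^-1 <= complex.Re x ->
  beta_const x N @[N --> \oo] --> (0 : cplx R).
Proof.
move=> hx.
have bd N : cnorm (beta_const x N) <= (N.+1%:R * wallis R N.+1)^-1.
  rewrite /beta_const cnormM cnormV cnorm_nat cnorm_prod.
  have -> : (N.+1%:R * wallis R N.+1)^-1 = N`!%:R / \prod_(j < N.+1) (j%:R + 2^-1).
    rewrite /wallis prodf_div.
    have -> : \prod_(i < N.+1) (i.+1%:R : R) = N.+1`!%:R.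
      by rewrite fact_prod natr_prod big_add1/= big_mkord.
    have p0 : 0 < \prod_(i < N.+1) (i%:R + 2^-1 : R).
      by apply: prodr_gt0 => i _; rewrite ltr_wpDl.
    have f0 : N`!%:R != 0 :> R by rewrite pnatr_eq0 -lt0n fact_gt0.
    rewrite factS natrM; move: p0 f0; set P := \prod_(i < _) _.
    have : N.+1%:R != 0 :> R by rewrite pnatr_eq0.
    move: (N.+1%:R : R) => M M0 /lt0r_neq0 P0 f0; field.
    by rewrite M0 P0 f0.
  rewrite ler_wpM2l// lef_pV2 ?posrE; last 2 first.
  - by apply: prodr_gt0 => i _; rewrite cnorm_gt0; exact: nonpole_Re.
  - by apply: prodr_gt0 => i _; rewrite ltr_wpDl.
  apply: ler_prod => i _; rewrite addr_ge0 ?invr_ge0//=.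
  apply: le_trans (Re_le_cnorm _); rewrite !ReD Re_nat/=; lra.
apply/cvgcP => e e0.
near=> N; rewrite sub0r cnormN; apply: le_lt_trans (bd N) _.
have w0 : 0 < N.+1%:R * wallis R N.+1 by rewrite mulr_gt0// wallis_gt0.
have hN : 4 / e ^+ 2 < N.+1%:R.
  apply: (@lt_trans _ _ N%:R); last by rewrite ltr_nat.
  by near: N; exact: nbhs_infty_gtr.
have e20 : 0 < e ^+ 2 by rewrite exprn_gt0.
rewrite ltr_pdivrMr// in hN.
have := wallis_lower N; move: (N.+1%:R * wallis R N.+1) w0 => q q0 hq.
rewrite -(div1r q) ltr_pdivrMr//.
have : 1 ^+ 2 < (e * q) ^+ 2 by rewrite exprMn expr1n; nra.
by rewrite ltr_pXn2r// nnegrE// mulr_ge0// ltW.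
Unshelve. all: by end_near. Qed.

Lemma dominated_sbin n x (b : nat -> cplx R) (B : R) :
  0 <= B -> cnorm (x - n%:R) <= 2^-1 ->
  (forall k, cnorm (b k) <= B / k.+1%:R) ->
  dominated ((2 * n%:R + 1) ^+ n * B) (fun k => sbin x k * b k).
Proof.
move=> B0 xn bB k; rewrite cnormM /majorant.
have -> : (2 * n%:R + 1) ^+ n * B * (wallis R k / k.+1%:R) =
   (2 * n%:R + 1) ^+ n * wallis R k * (B / k.+1%:R) by ring.
by apply: ler_pM; rewrite ?cnorm_ge0//; exact: sbin_le.
Qed.

Lemma cnorm_inv_le z (c : R) k : 0 < c ->
  c * k.+1%:R <= cnorm z -> cnorm z^-1 <= c^-1 / k.+1%:R.
Proof.
move=> c0 h; have ck : 0 < c * k.+1%:R by rewrite mulr_gt0.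
by rewrite cnormV -invfM lef_pV2// posrE// (lt_le_trans ck).
Qed.

Lemma beta_series n x s : cnorm (x - n%:R) <= 2^-1 -> nonpole s ->
  Gamma (x + 1) * Gamma s / Gamma (x + s + 1) =
  csum (fun k => sbin x k * (s + k%:R)^-1).
Proof.
move=> xn ns; have hx := Re_ball xn; have nx := nonpole_Re hx.
have [c c0 hc] := nonpole_bound ns.
have bc := beta_seq_cvg nx ns.
have bE N : beta_seq x s N = beta_const x N +
    csum (fun k => beta_coef x N k * (s + k%:R)^-1).
  rewrite beta_seq_partial_fractions//; congr (_ + _).
  rewrite (@csum_finite _ _ N.+1); first by rewrite big_mkord.
  move=> k Nk; rewrite /beta_coef (bigD1 (Ordinal Nk))//= subrr.
  by rewrite !mul0r.
have inv k : cnorm (s + k%:R)^-1 <= c^-1 / k.+1%:R by exact: cnorm_inv_le.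
have dom := dominated_sbin (ltW (_ : 0 < c^-1)) xn inv.
have /tannery -/(_ (fun k => sbin x k * (s + k%:R)^-1)) T : 
   \forall N \near \oo, dominated ((2 * n%:R + 1) ^+ n * c^-1)
      (fun k => beta_coef x N k * (s + k%:R)^-1).
  near=> N; move=> k; apply: le_trans (dom _ k); last by rewrite invr_gt0.
  by rewrite !cnormM ler_wpM2r ?cnorm_ge0// beta_coef_le.
have [|_ {}T] := T.
  by move=> k; exact: cvgM (@beta_coef_cvg x k) (cvg_cst _).
have : beta_seq x s N @[N --> \oo] --> 0 + csum (fun k => sbin x k * (s + k%:R)^-1).
  have -> : beta_seq x s = fun N => beta_const x N +
    csum (fun k => beta_coef x N k * (s + k%:R)^-1) by apply/funext.
  exact: cvgD (beta_const_cvg hx) T.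
rewrite add0r => bc'; exact: (cvg_unique (@norm_hausdorff _ _) bc bc').
Unshelve. all: by end_near. Qed.

End beta_series.

(** * Differentiation in s *)

Section termwise_derivatives.
Variable R : realType.
Implicit Types (z x s h : cplx R) (N k n m : nat).

(** The series formulas hold only near the point considered, which is enough for a derivative
    there. *)
Lemma derive1_local (f g : cplx R -> cplx R) z l (e : R) : 0 < e ->
  (forall y, cnorm (y - z) < e -> f y = g y) ->
  h^-1 * (g (h + z) - g z) @[h --> (0 : cplx R)^'] --> l ->
  derive1 f z = l.
Proof.
move=> e0 fg gl; apply: cvg_lim; first exact: norm_hausdorff.
apply/cvgcP => d d0; move/cvgcP: gl => /(_ d d0) gl.
near=> h; rewrite /GRing.scale/= !fg ?subrr ?cnorm0 ?addrK//; near: h => //.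
exact: near0_cnorm.
Unshelve. all: by end_near. Qed.

Lemma cvg_inv_shift s k : s + k%:R != 0 ->
  (h + s + k%:R)^-1 @[h --> (0 : cplx R)^'] --> (s + k%:R)^-1.
Proof.
move=> sk; apply: cvgV => //.
apply/cvgcP => e e0; near=> h.
have -> : s + k%:R - (h + s + k%:R) = - h by ring.
by rewrite cnormN; near: h; exact: near0_cnorm.
Unshelve. all: by end_near. Qed.

Lemma cvg_exprn (T : Type) (F : set_system T) {FF : Filter F}
    (f : T -> cplx R) (l : cplx R) j :
  f x @[x --> F] --> l -> (f x) ^+ j @[x --> F] --> l ^+ j.
Proof.
move=> fl; elim: j => [|j IH]; first exact: cvg_cst.
rewrite exprS; under eq_fun do rewrite exprS.
exact: cvgM fl IH.
Qed.

(** A shift below [c/2] costs at most [(c/2)(k+1)] for every [k] at once, whence bounds uniform in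
    [h]. *)
Lemma nonpole_near s (c : R) z : 0 < c ->
  (forall k, c * k.+1%:R <= cnorm (s + k%:R)) ->
  cnorm (z - s) < c / 2 -> forall k, c / 2 * k.+1%:R <= cnorm (z + k%:R).
Proof.
move=> c0 hc zs k; have := hc k; have := ler_cnormB (s + k%:R) (s - z).
have -> : s + k%:R - (s - z) = z + k%:R by ring.
rewrite (cdistC s); have : (1 : R) <= k.+1%:R by rewrite ler1n.
by move: (k.+1%:R : R) => y *; nra.
Qed.

Lemma bound_nonpole (c : R) z : 0 < c ->
  (forall k, c * k.+1%:R <= cnorm (z + k%:R)) -> nonpole z.
Proof.
by move=> c0 hc k; rewrite -cnorm_gt0; apply: lt_le_trans (hc k); rewrite mulr_gt0.
Qed.

Lemma cnorm_invX_le z (c : R) m k : 0 < c ->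
  c * k.+1%:R <= cnorm z -> cnorm (z^-1 ^+ m.+1) <= c^-1 ^+ m.+1 / k.+1%:R.
Proof.
move=> c0 h; have h1 := cnorm_inv_le c0 h.
have c1 : 0 <= c^-1 by rewrite invr_ge0 ltW.
have h2 : cnorm z^-1 <= c^-1.
  by apply: le_trans h1 _; rewrite ler_piMr// invf_le1// ler1n.
rewrite exprS cnormM cnormX exprS mulrAC.
by apply: ler_pM => //; rewrite ?exprn_ge0 ?cnorm_ge0// lerXn2r ?nnegrE ?cnorm_ge0.
Qed.

(** The difference quotient in [s] of [(s+k)^(-m-1)] with its [h] cancelled: for [u = h+s+k] and
    [v = s+k], use [1/u - 1/v = -h/(u v)] and the factorization of a difference of powers. *)
Definition inv_quotient m s h k : cplx R :=
  - ((h + s + k%:R)^-1 * (s + k%:R)^-1 *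
     \sum_(0 <= i < m.+1) (h + s + k%:R)^-1 ^+ (m - i) * (s + k%:R)^-1 ^+ i).

Lemma inv_quotientE m s h k : h != 0 -> s + k%:R != 0 -> h + s + k%:R != 0 ->
  h^-1 * ((h + s + k%:R)^-1 ^+ m.+1 - (s + k%:R)^-1 ^+ m.+1) = inv_quotient m s h k.
Proof.
move=> h0 s0 hs0; rewrite subrXX /inv_quotient big_mkord mulrA -mulNr.
congr (_ * _); by field; rewrite h0 s0 hs0.
Qed.

(** One reciprocal keeps its decay [1/(k+1)]; the other [m + 1] are only bounded by [B]. *)
Lemma inv_quotient_le m s h k (B : R) : 0 <= B ->
  cnorm (h + s + k%:R)^-1 <= B / k.+1%:R -> cnorm (s + k%:R)^-1 <= B / k.+1%:R ->
  cnorm (inv_quotient m s h k) <= m.+1%:R * B ^+ m.+2 / k.+1%:R.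
Proof.
move=> B0; rewrite /inv_quotient.
move: (h + s + k%:R)^-1 (s + k%:R)^-1 => r r' hr hr'.
have Bk : B / k.+1%:R <= B by rewrite ler_piMr// invf_le1// ler1n.
have hrB := le_trans hr Bk; have hrB' := le_trans hr' Bk.
rewrite cnormN !cnormM.
have -> : m.+1%:R * B ^+ m.+2 / k.+1%:R = B / k.+1%:R * B * (B ^+ m *+ m.+1).
  by rewrite -mulr_natl !exprS; ring.
apply: ler_pM => //; rewrite ?mulr_ge0 ?cnorm_ge0//.
  by apply: ler_pM; rewrite ?cnorm_ge0.
apply: le_trans (ler_cnorm_sum _ _ _) _.
rewrite big_mkord -[X in _ *+ X]card_ord -sumr_const; apply: ler_sum => i _.
have im : (i <= m)%N by rewrite -ltnS.
rewrite cnormM !cnormX; have -> : B ^+ m = B ^+ (m - i) * B ^+ i by rewrite -exprD subnK.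
by apply: ler_pM; rewrite ?exprn_ge0 ?cnorm_ge0// lerXn2r ?nnegrE ?cnorm_ge0.
Qed.

Lemma inv_quotient_cvg m s k : s + k%:R != 0 ->
  inv_quotient m s h k @[h --> (0 : cplx R)^'] -->
  - m.+1%:R * (s + k%:R)^-1 ^+ m.+2.
Proof.
move=> sk; have c := cvg_inv_shift sk; set r := (s + k%:R)^-1 in c *.
have -> : - m.+1%:R * r ^+ m.+2 = - (r * r * series (fun i => r ^+ (m - i) * r ^+ i) m.+1).
  rewrite /series/= (eq_big_nat _ _ (F2 := fun=> r ^+ m)).
    by rewrite big_mkord sumr_const card_ord -mulr_natl !exprS; ring.
  by move=> i /andP[_]; rewrite ltnS => im; rewrite -exprD subnK.
have S := @cvg_big_sum R _ (0 : cplx R)^' _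
  (fun h i => (h + s + k%:R)^-1 ^+ (m - i) * r ^+ i) (fun i => r ^+ (m - i) * r ^+ i) _ m.+1.
apply: cvgN; apply: cvgM; first exact: cvgM c (cvg_cst r).
apply: S => i; exact: cvgM (cvg_exprn c) (cvg_cst _).
Qed.

Definition beta_term m x s k : cplx R := sbin x k * (s + k%:R)^-1 ^+ m.+1.

Lemma beta_term_derive_s n m x s (c : R) :
  cnorm (x - n%:R) <= 2^-1 -> 0 < c ->
  (forall k, c * k.+1%:R <= cnorm (s + k%:R)) ->
  h^-1 * (csum (beta_term m x (h + s)) - csum (beta_term m x s))
    @[h --> (0 : cplx R)^'] -->
  - m.+1%:R * csum (beta_term m.+1 x s).
Proof.
move=> xn c0 hc.
have c20 : 0 < c / 2 by lra.
pose B := (c / 2)^-1; have B0 : 0 <= B by rewrite invr_ge0 ltW.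
have hc2 z : cnorm (z - s) < c / 2 -> forall k, c / 2 * k.+1%:R <= cnorm (z + k%:R).
  exact: nonpole_near c0 hc.
have ss : cnorm (s - s) < c / 2 by rewrite subrr cnorm0.
have dom z : cnorm (z - s) < c / 2 ->
    dominated ((2 * n%:R + 1) ^+ n * B ^+ m.+1) (beta_term m x z).
  move=> zs; apply: dominated_sbin => //; first exact: exprn_ge0.
  by move=> k; apply: cnorm_invX_le => //; exact: hc2.
have [] := @tannery R _ (0 : cplx R)^' _
  (fun h k => sbin x k * inv_quotient m s h k)
  (fun k => - m.+1%:R * beta_term m.+1 x s k)
  ((2 * n%:R + 1) ^+ n * (m.+1%:R * B ^+ m.+2)).
- near=> h; have hs : cnorm (h + s - s) < c / 2.
    by rewrite addrK; near: h; exact: near0_cnorm.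
  apply: dominated_sbin => //; first by rewrite mulr_ge0// exprn_ge0.
  by move=> k; apply: inv_quotient_le => //; apply: cnorm_inv_le => //; exact: hc2.
- move=> k; rewrite mulrCA; apply: cvgM; first exact: cvg_cst.
  exact/inv_quotient_cvg/(bound_nonpole c0 hc).
move=> _ T.
have -> : - m.+1%:R * csum (beta_term m.+1 x s) =
    csum (fun k => - m.+1%:R * beta_term m.+1 x s k).
  have d0 : dominated ((2 * n%:R + 1) ^+ n * B ^+ m.+2) (beta_term m.+1 x s).
    apply: dominated_sbin => //; first exact: exprn_ge0.
    by move=> k; apply: cnorm_invX_le => //; exact: hc2.
  by rewrite (csumZ _ d0).
apply/cvgcP => e e0; move/cvgcP: T => /(_ e e0) T.
near=> h; have hs : cnorm (h + s - s) < c / 2.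
  by rewrite addrK; near: h; exact: near0_cnorm.
rewrite (csum_diff _ (dom _ hs) (dom _ ss)).
have h0 : h != 0 by near: h; exact: nbhs_dnbhs_neq.
have -> : (fun k => h^-1 * (beta_term m x (h + s) k - beta_term m x s k)) =
    fun k => sbin x k * inv_quotient m s h k.
  apply/funext => k; rewrite -inv_quotientE//; last 2 first.
  - exact: bound_nonpole c0 hc k.
  - exact: bound_nonpole c20 (hc2 _ hs) k.
  by rewrite /beta_term; ring.
by near: h.
Unshelve. all: by end_near. Qed.

End termwise_derivatives.

(** * Differentiation in x *)

Section derivative_in_x.
Variable R : realType.
Implicit Types (z x s h : cplx R) (N k n m : nat).

(** The induction keeps [s] general: each derivative needs the previous formula on a whole
    neighbourhood, which [nonpole_near] keeps free of poles. *)
Lemma derive1n_beta n m x s : cnorm (x - n%:R) <= 2^-1 -> nonpole s ->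
  derive1n m (fun s => Gamma (x + 1) * Gamma s / Gamma (x + s + 1)) s =
  (-1) ^+ m * m`!%:R * csum (beta_term m x s).
Proof.
move=> xn; elim: m s => [|m IH] s ns.
  rewrite derive1n0 (beta_series xn ns) fact0 expr0 !mul1r.
  by congr csum; apply/funext => k; rewrite /beta_term expr1.
have [c c0 hc] := nonpole_bound ns; have c20 : 0 < c / 2 by lra.
rewrite derive1nS.
apply: (derive1_local c20 (g := fun s => (-1) ^+ m * m`!%:R * csum (beta_term m x s))).
  move=> y ys; apply: IH; exact: bound_nonpole c20 (nonpole_near c0 hc ys).
have -> : (-1) ^+ m.+1 * m.+1`!%:R * csum (beta_term m.+1 x s) =
    (-1) ^+ m * m`!%:R * (- m.+1%:R * csum (beta_term m.+1 x s)).
  by rewrite exprS factS natrM; ring.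
have -> : (fun h => h^-1 * ((-1) ^+ m * m`!%:R * csum (beta_term m x (h + s)) -
      (-1) ^+ m * m`!%:R * csum (beta_term m x s))) =
    fun h => (-1) ^+ m * m`!%:R *
      (h^-1 * (csum (beta_term m x (h + s)) - csum (beta_term m x s))).
  by apply/funext => h; rewrite -mulrBr mulrCA.
exact: cvgM (cvg_cst _) (beta_term_derive_s xn c0 hc).
Qed.

(* the difference quotient (sbin (h + n) k - sbin n k) / h, and the derivative
   of sbin at n when h = 0 *)
Fixpoint dsbin n h k : cplx R :=
  if k is k'.+1 then
    (dsbin n h k' * (k'%:R - n%:R) - sbin (h + n%:R) k') / k'.+1%:R
  else 0.

(** The recursion of [dsbin] is the product rule for differences, the last factor [k - h - n] being
    split into [k - n] and [-h]. *)
Lemma dsbinE n h k : sbin (h + n%:R) k - sbin n%:R k = h * dsbin n h k.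
Proof.
elim: k => [|k IH]; first by rewrite /sbin !big_ord0 subrr mulr0.
rewrite !sbinS /=.
have -> : sbin (h + n%:R) k = sbin n%:R k + h * dsbin n h k by rewrite -IH; ring.
by ring.
Qed.

(** The induction of [sbin_le] with an extra term [sbin (h + n) k]. The multiplier is now [k - n]
    exactly, and the spare [1/2] in the factor [k + 1/2] of [wallis] absorbs the extra term; hence
    the leading 2. *)
Lemma dsbin_le n h k : cnorm h <= 2^-1 ->
  cnorm (dsbin n h k) <= 2 * (2 * n%:R + 1) ^+ n * (2 * n%:R + 1) ^+ n * wallis R k.
Proof.
move=> hh; have n0 : (0 : R) <= n%:R by [].
pose a : R := 2 * n%:R + 1; have a1 : 1 <= a by rewrite /a; lra.
have a0 : 0 <= a by lra.
have A0 : 0 <= a ^+ n by exact: exprn_ge0.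
rewrite -/a.
suff H : cnorm (dsbin n h k) <= 2 * a ^+ n * a ^+ minn k n * wallis R k.
  apply: le_trans H _; apply: ler_wpM2r; first exact/ltW/wallis_gt0.
  apply: ler_wpM2l; first by rewrite mulr_ge0.
  by apply: ler_weXn2l; rewrite ?geq_minr.
elim: k => [|k IH] /=.
  by rewrite cnorm0 !mulr_ge0// ?exprn_ge0// ltW// wallis_gt0.
have sb : cnorm (sbin (h + n%:R) k) <= a ^+ n * wallis R k.
  by apply: sbin_le; rewrite addrK.
rewrite cnormM cnormV cnorm_nat wallisS !mulrA ler_wpM2r ?invr_ge0//.
apply: le_trans (ler_cnormD _ _) _; rewrite cnormN cnormM.
have -> : cnorm (k%:R - n%:R : cplx R) = `|k%:R - n%:R|.
  by rewrite !natrC -rmorphB/= cnorm_real.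
move: IH sb (wallis_gt0 R k) (cnorm_ge0 (dsbin n h k)).
move: (cnorm (dsbin n h k)) (cnorm (sbin _ k)) (wallis R k) => d b w IH sb w0 d0.
have k0 : (0 : R) <= k%:R by [].
have [nk|kn] := leqP n k.
  rewrite (minn_idPr nk) in IH; rewrite (minn_idPr (leqW nk)).
  rewrite ger0_norm ?subr_ge0 ?ler_nat//.
  have q1 : 1 <= a ^+ n by exact: exprn_ege1.
  have t1 : d * (k%:R - n%:R) <= 2 * a ^+ n * a ^+ n * w * k%:R.
    apply: (@le_trans _ _ (d * k%:R)); first by rewrite ler_wpM2l//; lra.
    by rewrite ler_wpM2r.
  have t2 : a ^+ n * w <= a ^+ n * w * a ^+ n.
    by rewrite ler_peMr// mulr_ge0// ltW.
  by lra.
rewrite (minn_idPl (ltnW kn)) in IH; rewrite (minn_idPl kn) exprS.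
rewrite ler0_norm ?subr_le0 ?ler_nat ?(ltnW kn)// opprB.
have q1 : 1 <= a ^+ k by exact: exprn_ege1.
pose E := a ^+ n * a ^+ k * w.
have E0 : 0 <= E by rewrite !mulr_ge0 ?exprn_ge0// ltW.
have t1 : d * (n%:R - k%:R) <= 2 * E * n%:R.
  apply: (@le_trans _ _ (d * n%:R)); first by rewrite ler_wpM2l//; lra.
  by rewrite ler_wpM2r//; apply: le_trans IH _; rewrite /E; lra.
have t2 : a ^+ n * w <= E.
  by rewrite /E mulrAC ler_peMr// mulr_ge0// ltW.
have -> : 2 * a ^+ n * (a * a ^+ k) * w * (k%:R + 2^-1) = 2 * E * (a * (k%:R + 2^-1)).
  by rewrite /E; ring.
(* An equality at [k = 0], which dictates [a = 2n + 1]. *)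
have t3 : n%:R + 2^-1 <= a * (k%:R + 2^-1) by rewrite /a; nra.
have : 2 * E * (n%:R + 2^-1) <= 2 * E * (a * (k%:R + 2^-1)).
  by rewrite ler_wpM2l// mulr_ge0.
by lra.
Qed.

Lemma sbin_cvg n k : sbin (h + n%:R) k @[h --> (0 : cplx R)^'] --> sbin n%:R k.
Proof.
elim: k => [|k IH].
  rewrite /sbin big_ord0; under eq_fun do rewrite big_ord0.
  exact: cvg_cst.
rewrite sbinS; under eq_fun do rewrite sbinS.
apply: (cvgM IH); apply: cvgM; last exact: cvg_cst.
apply/cvgcP => e e0; near=> h.
have -> : k%:R - n%:R - (k%:R - (h + n%:R)) = h by ring.
by near: h; exact: near0_cnorm.
Unshelve. all: by end_near. Qed.

Lemma dsbin_cvg n k : dsbin n h k @[h --> (0 : cplx R)^'] --> dsbin n 0 k.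
Proof.
elim: k => [|k IH]; first exact: (cvg_cst (0 : cplx R)).
rewrite [dsbin n 0 k.+1]/= add0r.
exact: cvgM (cvgB (cvgM IH (cvg_cst _)) (@sbin_cvg n k)) (cvg_cst _).
Qed.

Lemma beta_term_derive_x n m s (c : R) : 0 < c ->
  (forall k, c * k.+1%:R <= cnorm (s + k%:R)) ->
  let a k := dsbin n 0 k * (s + k%:R)^-1 ^+ m.+1 in
  h^-1 * (csum (beta_term m (h + n%:R) s) -
          csum (beta_term m n%:R s)) @[h --> (0 : cplx R)^'] --> csum a
  /\ series a N @[N --> \oo] --> csum a.
Proof.
move=> c0 hc a.
pose A : R := 2 * (2 * n%:R + 1) ^+ n * (2 * n%:R + 1) ^+ n.
pose B := c^-1 ^+ m.+1.
have B0 : 0 <= B by rewrite exprn_ge0// invr_ge0 ltW.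
have h20 : 0 < 2^-1 :> R by rewrite invr_gt0.
have inv k : cnorm ((s + k%:R)^-1 ^+ m.+1) <= B / k.+1%:R by exact: cnorm_invX_le.
have dom h : cnorm h <= 2^-1 -> dominated ((2 * n%:R + 1) ^+ n * B)
    (beta_term m (h + n%:R) s).
  by move=> hh; apply: dominated_sbin => //; rewrite addrK.
have [] := @tannery R _ (0 : cplx R)^' _
  (fun h k => dsbin n h k * (s + k%:R)^-1 ^+ m.+1) a (A * B).
- near=> h; move=> k.
  have hh : cnorm h <= 2^-1 by apply: ltW; near: h; exact: near0_cnorm.
  rewrite cnormM /majorant; have -> : A * B * (wallis R k / k.+1%:R) =
    A * wallis R k * (B / k.+1%:R) by ring.
  by apply: ler_pM; rewrite ?cnorm_ge0//; exact: dsbin_le.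
- by move=> k; exact: cvgM (@dsbin_cvg n k) (cvg_cst _).
move=> aD T; split; last exact: cvg_csum aD.
apply/cvgcP => e e0; move/cvgcP: T => /(_ e e0) T.
near=> h; have hh : cnorm h <= 2^-1 by apply: ltW; near: h; exact: near0_cnorm.
have d0 : dominated ((2 * n%:R + 1) ^+ n * B) (beta_term m n%:R s).
  by have := dom 0; rewrite add0r cnorm0; apply; exact: ltW.
rewrite (csum_diff _ (dom _ hh) d0).
have h0 : h != 0 by near: h; exact: nbhs_dnbhs_neq.
have -> : (fun k => h^-1 * (beta_term m (h + n%:R) s k - beta_term m n%:R s k)) =
    fun k => dsbin n h k * (s + k%:R)^-1 ^+ m.+1.
  apply/funext => k; rewrite /beta_term -mulrBl dsbinE -mulrA.
  by rewrite mulKf.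
by near: h.
Unshelve. all: by end_near. Qed.

Lemma derive1_derive1n_beta n m p (a : nat -> cplx R) : nonpole p ->
  a = (fun k => dsbin n 0 k * (p + k%:R)^-1 ^+ m.+1) ->
  derive1 (fun x : cplx R => derive1n m (fun s : cplx R =>
      Gamma (x + 1) * Gamma s / Gamma (x + s + 1)) p) n%:R =
    (-1) ^+ m * m`!%:R * csum a
  /\ series a N @[N --> \oo] --> csum a.
Proof.
move=> np ->; have [c c0 hc] := nonpole_bound np.
have [T S] := beta_term_derive_x n m c0 hc; split => //.
have h20 : 0 < 2^-1 :> R by rewrite invr_gt0.
apply: (derive1_local h20 (g := fun x => (-1) ^+ m * m`!%:R * csum (beta_term m x p))).
  by move=> y yn; apply: (@derive1n_beta n) => //; exact: ltW.
have -> : (fun h => h^-1 * ((-1) ^+ m * m`!%:R * csum (beta_term m (h + n%:R) p) -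
      (-1) ^+ m * m`!%:R * csum (beta_term m n%:R p))) =
    fun h => (-1) ^+ m * m`!%:R * (h^-1 *
      (csum (beta_term m (h + n%:R) p) - csum (beta_term m n%:R p))).
  by apply/funext => h; rewrite -mulrBr mulrCA.
exact: cvgM (cvg_cst _) T.
Qed.

Lemma sbin_nat n k : (k <= n)%N -> sbin (n%:R : cplx R) k = (-1) ^+ k * 'C(n, k)%:R.
Proof.
elim: k => [|k IH] kn; first by rewrite /sbin big_ord0 bin0 expr0 mul1r.
have bE : k.+1%:R * 'C(n, k.+1)%:R = (n%:R - k%:R) * 'C(n, k)%:R :> cplx R.
  by rewrite -natrB ?(ltnW kn)// -!natrM mul_bin_left.
rewrite sbinS IH ?(ltnW kn)//.
apply: (mulfI (natr_neq0 R k)); rewrite [RHS]mulrCA bE exprS.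
have := natr_neq0 R k; move: (k.+1%:R : cplx R) => q q0.
by field.
Qed.

Lemma sbin_nat0 n k : (n < k)%N -> sbin (n%:R : cplx R) k = 0.
Proof. by move=> nk; rewrite /sbin (bigD1 (Ordinal nk))//= subrr !mul0r. Qed.

Lemma harmS n : harm (cplx R) n.+1 = harm (cplx R) n + n.+1%:R^-1.
Proof. by rewrite /harm big_nat_recr. Qed.

(** The ratio [dsbin / sbin] is a logarithmic derivative: for [k < n], the new factor [k - x] adds
    [1/(n - k)] to it. *)
Lemma dsbin_low n k : (k <= n)%N ->
  dsbin n 0 k = (-1) ^+ k * 'C(n, k)%:R * (harm (cplx R) n - harm (cplx R) (n - k)).
Proof.
elim: k => [|k IH] kn; first by rewrite /= subn0 subrr mulr0.
rewrite /= add0r IH ?(ltnW kn)// sbin_nat ?(ltnW kn)//.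
have bE : k.+1%:R * 'C(n, k.+1)%:R = (n%:R - k%:R) * 'C(n, k)%:R :> cplx R.
  by rewrite -natrB ?(ltnW kn)// -!natrM mul_bin_left.
have -> : harm (cplx R) (n - k) = harm (cplx R) (n - k.+1) + (n%:R - k%:R)^-1.
  by rewrite -natrB ?(ltnW kn)// -(subnSK kn) harmS.
have nk0 : n%:R - k%:R != 0 :> cplx R by rewrite subr_eq0 eqr_nat neq_ltn kn orbT.
apply: (mulfI (natr_neq0 R k)).
transitivity ((-1) ^+ k.+1 * (k.+1%:R * 'C(n, k.+1)%:R) *
  (harm (cplx R) n - harm (cplx R) (n - k.+1))); last by ring.
rewrite bE exprS.
have := natr_neq0 R k; move: (k.+1%:R : cplx R) => q q0.
by field; rewrite q0 nk0.
Qed.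

(** The factor [n - x] vanishes at [x = n], so at index [n + 1] only its derivative [-1] survives
    and the harmonic numbers drop out. Beyond that [sbin n k = 0], and the recursion is a plain
    product. *)
Lemma dsbin_high n j :
  dsbin n 0 (n + j.+1) = - ((-1) ^+ n / (j.+1%:R * 'C(n + j.+1, j.+1)%:R)).
Proof.
elim: j => [|j IH].
  rewrite addn1 /= add0r dsbin_low// sbin_nat// binn subrr mulr0 sub0r mulr1.
  by rewrite bin1 mul1r mulNr.
rewrite addnS [LHS]/= -/dsbin IH add0r sbin_nat0; last by rewrite -addn1 leq_add2l.
have bE : j.+2%:R * 'C((n + j.+1).+1, j.+2)%:R =
    (n + j.+1).+1%:R * 'C(n + j.+1, j.+1)%:R :> cplx R.
  by rewrite -!natrM -mul_bin_diag.
have -> : (n + j.+1)%:R - n%:R = j.+1%:R :> cplx R.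
  by rewrite natrD addrAC subrr add0r.
rewrite bE subr0.
have b0 : 'C(n + j.+1, j.+1)%:R != 0 :> cplx R.
  by rewrite pnatr_eq0 -lt0n bin_gt0 leq_addl.
have j0 := natr_neq0 R j; have q0 := natr_neq0 R (n + j.+1).
move: ((n + j.+1).+1%:R : cplx R) ('C(n + j.+1, j.+1)%:R : cplx R)
  (j.+1%:R : cplx R) q0 b0 j0.
by move=> q b u *; field; do ?[apply/andP; split].
Qed.

End derivative_in_x.

Theorem theorem3p7 (R : realType) (p : cplx R) (m n : nat)
    (hp : forall j : nat, p <> - j%:R) :
  (\sum_(1 <= k < N.+1)
      (-1) ^+ n / (k%:R * (p + n%:R + k%:R) ^+ m.+1 * 'C(n + k, k)%:R))
    @[N --> \oo] -->
  (\sum_(0 <= k < n.+1)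
      (-1) ^+ k / (p + k%:R) ^+ m.+1 * 'C(n, k)%:R
      * (harm (cplx R) n - harm (cplx R) (n - k)))
  - (-1) ^+ m / m`!%:R
    * derive1 (fun x : cplx R =>
        derive1n m (fun s : cplx R =>
          Gamma (x + 1) * Gamma s / Gamma (x + s + 1)) p) n%:R.
Proof.
have np : nonpole p by move=> k; rewrite addr_eq0; exact/eqP/hp.
pose a k : cplx R := dsbin n 0 k * (p + k%:R)^-1 ^+ m.+1.
have [-> S] := derive1_derive1n_beta np (erefl a).
have -> : (-1) ^+ m / m`!%:R * ((-1) ^+ m * m`!%:R * csum a) = csum a.
  have f0 : m`!%:R != 0 :> cplx R by rewrite pnatr_eq0 -lt0n fact_gt0.
  rewrite [_ * csum a]mulrC [RHS](_ : _ = csum a * ((-1) ^+ m * (-1) ^+ m)).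
    by field.
  by rewrite -exprD addnn -mul2n exprM sqrrN expr1n expr1n mulr1.
have lowE : \sum_(0 <= k < n.+1) (-1) ^+ k / (p + k%:R) ^+ m.+1 * 'C(n, k)%:R
      * (harm (cplx R) n - harm (cplx R) (n - k)) = series a n.+1.
  apply: eq_big_nat => k /andP[_]; rewrite ltnS => kn.
  by rewrite /a dsbin_low// exprVn; ring.
rewrite lowE.
(* The summands are [- a (n + k)], so the infinite sum is minus the tail of [csum a] beyond index
   [n]; the finite sum consists of its first [n + 1] terms. *)
have -> : (fun N => \sum_(1 <= k < N.+1)
      (-1) ^+ n / (k%:R * (p + n%:R + k%:R) ^+ m.+1 * 'C(n + k, k)%:R)) =
    fun N => series a n.+1 - series a (N + n.+1).
  apply/funext => N; rewrite series_addn opprD addNKr.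
  rewrite big_add1/= -sumrN.
  rewrite [RHS](_ : _ = \sum_(0 + n.+1 <= k < N + n.+1) - a k) // big_addn addnK.
  apply: eq_bigr => k _; rewrite /a.
  have -> : (k + n.+1 = n + k.+1)%N by rewrite addnS -addSn addnC.
  rewrite dsbin_high natrD addrA exprVn.
  by rewrite mulNr opprK !invfM; ring.
by apply: cvgB; [exact: cvg_cst | rewrite cvg_shiftn].
Qed.
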